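(* Let $s\ge 0$ and $t\ge 1$ be fixed integers with $s+t\ge 2$, and let $H_{s,t}$ be a fixed graph consisting of $s$ triangles and $t$ odd cycles, each of length at least $5$ (the lengths of these $t$ cycles being arbitrary fixed odd integers at least $5$, not necessarily equal), all $s+t$ cycles sharing exactly one common vertex and being otherwise pairwise vertex-disjoint. Then there exists $n_0=n_0(H_{s,t})\in\mathbb{N}$ such that for all $n\ge n_0$, $$\operatorname{ar}(n,H_{s,t}) = t_2(n)+(s+t-2)^2+1 .$$
   Context: All graphs are finite and simple. An edge-coloring of the complete graph $K_n$ is an arbitrary assignment of colors to its edges (not necessarily proper). An edge-colored graph is rainbow if its edges have pairwise distinct colors. For a fixed graph $H$, the anti-Ramsey number $\operatorname{ar}(n,H)$ is the maximum number of colors $|c(E(K_n))|$ appearing in an edge-coloring $c$ of $K_n$ that contains no rainbow copy of $H$ (a copy of $H$ is a subgraph, not necessarily induced, isomorphic to $H$). $T_2(n)$ is the complete bipartite graph on $n$ vertices whose part sizes differ by at most one, and $t_2(n)=e(T_2(n))=\lfloor n^2/4\rfloor$ is its number of edges. *)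

(* Defs.v *)
From mathcomp Require Import all_boot zify.

Set Implicit Arguments.
Unset Strict Implicit.
Unset Printing Implicit Defensive.

Record sgraph := SGraph {
  vertex :> finType;
  edges : {set {set vertex}};
  edgesP : forall e, e \in edges -> #|e| = 2 }.

Lemma complete_edgesP n (e : {set 'I_n}) :
  e \in [set e : {set 'I_n} | #|e| == 2] -> #|e| = 2.
Proof. by rewrite inE => /eqP. Qed.

Definition K (n : nat) : sgraph := SGraph (@complete_edgesP n).

Lemma turan2_edgesP n (e : {set 'I_n}) :
  e \in [set [set p.1; p.2] | p in [set p : 'I_n * 'I_n | odd p.1 != odd p.2]] ->
  #|e| = 2.
Proof.
case/imsetP=> -[x y]; rewrite inE /= => xy ->; rewrite cards2.
by case: (x =P y) xy => [->|]; rewrite ?eqxx.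
Qed.

(* The two parts are the even and the odd elements of {0, ..., n-1}. *)
Definition T2 (n : nat) : sgraph := SGraph (@turan2_edgesP n).

Definition t2 (n : nat) : nat := #|edges (T2 n)|.

Lemma card_odd_ord n : #|[set x : 'I_n | odd x]| = n./2.
Proof.
rewrite -sum1_card (eq_bigl (fun x : 'I_n => odd x)); last by move=> x; rewrite inE.
rewrite big_mkcond /=.
elim: n => [|n IH]; first by rewrite big_ord0.
by rewrite big_ord_recr /= IH uphalf_half addnC; case: (odd n).
Qed.

Lemma t2E n : t2 n = n ^ 2 %/ 4.
Proof.
pose O := [set x : 'I_n | odd x].
have -> : t2 n = #|setX (~: O) O|.
  have inj : {in setX (~: O) O &, injective (fun p : 'I_n * 'I_n => [set p.1; p.2])}.
    move=> [x y] [u v]; rewrite !inE /= => /andP[nx oy] /andP[nu ov] e.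
    have /setP ee := e; have := ee x; rewrite !inE eqxx /= => /esym/orP[]/eqP xE;
      last by rewrite xE ov in nx.
    have := ee y; rewrite !inE eqxx orbT => /esym/orP[]/eqP yE;
      first by rewrite yE (negPf nu) in oy.
    by rewrite xE yE.
  rewrite -(card_in_imset inj); apply: eq_card; apply/setP.
  apply/eqP; rewrite eqEsubset; apply/andP; split; apply/subsetP => e.
    case/imsetP=> -[x y]; rewrite inE /= => xy ->; apply/imsetP.
    case ox: (odd x); last first.
      by exists (x, y); rewrite ?inE //= ox; move: xy; rewrite ox; case: (odd y).
    exists (y, x); last by rewrite setUC.
    by rewrite !inE /= ox andbT; move: xy; rewrite ox; case: (odd y).
  case/imsetP=> -[x y]; rewrite !inE /= => /andP[nx oy] ->.
  by apply/imsetP; exists (x, y); rewrite ?inE //= (negPf nx) oy.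
rewrite cardsX cardsCs setCK card_ord /O card_odd_ord.
have nE := odd_double_half n; set h := n./2 in nE *.
have -> : n - h = odd n + h by lia.
have -> : n ^ 2 = (odd n + h) * h * 4 + odd n.
  by rewrite -[in LHS]nE; case: (odd n); rewrite -mul2n; nia.
by rewrite divnMDl // divn_small ?addn0 //; case: (odd n).
Qed.

Section Copies.
Variables H G : sgraph.

Definition copy_edges (f : {ffun H -> G}) : {set {set G}} :=
  [set f @: e | e : {set H} in edges H].

(* [f] identifies [H] with a (not necessarily induced) subgraph of [G]. *)
Definition is_copy (f : {ffun H -> G}) : bool :=
  injectiveb f && (copy_edges f \subset edges G).

(* Only the values of a coloring [c] on [edges G] are relevant. *)
Definition rainbow (C : eqType) (c : {set G} -> C) (F : {set {set G}}) : bool :=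
  [forall e in F, forall e' in F, (c e == c e') ==> (e == e')].

Definition has_rainbow_copy (C : eqType) (c : {set G} -> C) : bool :=
  [exists f : {ffun H -> G}, is_copy f && rainbow c (copy_edges f)].

End Copies.

Definition ncolors (G : sgraph) (C : eqType) (c : {set G} -> C) : nat :=
  size (undup [seq c e | e in edges G]).

(* An edge-coloring of K_n uses at most 'C(n, 2) colors, so a palette of that
   size loses nothing; see [arP] for arbitrary palettes. *)
Definition ar (n : nat) (H : sgraph) : nat :=
  \max_(c : {ffun {set K n} -> 'I_('C(n, 2))} | ~~ has_rainbow_copy H c)
    ncolors c.

Section ArMax.
Variables (n : nat) (H : sgraph).

Lemma eq_rainbow_copy (C C' : eqType) (c : {set K n} -> C) (c' : {set K n} -> C') :
  {in edges (K n) &, forall e e', (c e == c e') = (c' e == c' e')} ->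
  has_rainbow_copy H c = has_rainbow_copy H c'.
Proof.
move=> cc'; apply: eq_existsb => f; rewrite /is_copy -!andbA.
case: (injectiveb f) => //=; case: (boolP (_ \subset _)) => //= /subsetP sub.
apply: eq_forallb => e; case: (boolP (e \in _)) => //= /sub eK.
apply: eq_forallb => e'; case: (boolP (e' \in _)) => //= /sub eK'.
by rewrite cc'.
Qed.

Lemma leq_ar (C : eqType) (c : {set K n} -> C) :
  ~~ has_rainbow_copy H c -> ncolors c <= ar n H.
Proof.
move=> cH; pose U := undup [seq c e | e in edges (K n)].
have sU : size U <= 'C(n, 2).
  rewrite (leq_trans (size_undup _)) // size_map -cardE.
  by rewrite -[n in 'C(n, _)]card_ord -cardsT -cards_draws subset_leq_card //;
    apply/subsetP => e; rewrite !inE subsetT.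
case: (posnP (ncolors c)) => [-> //|c_gt0].
have inU e : e \in edges (K n) -> c e \in U.
  by move=> eK; rewrite mem_undup; apply/imageP; exists e.
pose P := Ordinal (leq_trans c_gt0 sU).
pose c' := [ffun e : {set K n} => insubd P (index (c e) U)].
have c'E e : e \in edges (K n) -> c' e = index (c e) U :> nat.
  move=> eK; rewrite ffunE val_insubd.
  by rewrite (leq_trans _ sU) // index_mem inU.
have cc' : {in edges (K n) &, forall e e', (c e == c e') = (c' e == c' e')}.
  move=> e e' eK eK'; apply/eqP/eqP => [ce|/(congr1 val)/=].
    by apply: val_inj; rewrite /= !c'E // ce.
  by rewrite !c'E // => /(congr1 (nth (c e) U)); rewrite !nth_index ?inU.
have c'H : ~~ has_rainbow_copy H c' by rewrite -(eq_rainbow_copy cc').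
apply: (@leq_trans (ncolors c')); last first.
  exact: (@leq_bigmax_cond _ _ (fun c : {ffun {set K n} -> 'I_('C(n, 2))} => ncolors c) c' c'H).
rewrite /ncolors -/U -(size_map (index^~ U)).
rewrite -(size_map (@nat_of_ord _) (undup [seq c' e | e in _])); apply: uniq_leq_size.
  rewrite map_inj_in_uniq ?undup_uniq // => a b aU bU.
  by move=> /(congr1 (nth a U)); rewrite !nth_index.
move=> z /mapP[a aU ->]; move: aU; rewrite mem_undup => /imageP[e eK ->].
by rewrite -c'E //; apply/map_f; rewrite mem_undup; apply/imageP; exists e.
Qed.

Lemma arP (m : nat) :
  (exists (C : eqType) (c : {set K n} -> C), ~~ has_rainbow_copy H c) ->
  ar n H = m <->
  (exists (C : eqType) (c : {set K n} -> C),
      ~~ has_rainbow_copy H c /\ ncolors c = m) /\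
  (forall (C : eqType) (c : {set K n} -> C),
      ~~ has_rainbow_copy H c -> ncolors c <= m).
Proof.
move=> ex.
have att : exists (C : eqType) (c : {set K n} -> C),
    ~~ has_rainbow_copy H c /\ ncolors c = ar n H.
  case: (posnP (ar n H)) => [ar0|ar_gt0].
    case: ex => C [c cH]; exists C, c; split=> //.
    by apply/eqP; rewrite ar0 -leqn0 -ar0 leq_ar.
  have [c cH|c0] := pickP
      (fun c : {ffun {set K n} -> 'I_('C(n, 2))} => ~~ has_rainbow_copy H c).
    have [c' c'H E] : {c' : {ffun {set K n} -> 'I_('C(n, 2))} |
        ~~ has_rainbow_copy H c' & ar n H = ncolors c'}.
      by apply: eq_bigmax_cond; apply/card_gt0P; exists c.
    by exists _, c'.
  by move: ar_gt0; rewrite /ar big_pred0.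
split=> [<-|[[C [c [cH <-]]] up]]; first by split=> // C c; exact: leq_ar.
apply/eqP; rewrite eqn_leq leq_ar // andbT.
by case: att => C' [c' [c'H <-]]; exact: up.
Qed.

End ArMax.

Definition cycle_edges (V : finType) (c : seq V) : {set {set V}} :=
  [set [set x; next c x] | x in c].

(* [C (inl i)] are the triangles and [C (inr j)] the longer odd cycles, each
   given by its vertices in cyclic order; [v] is the common vertex. *)
Definition is_Hst (s t : nat) (H : sgraph) : Prop :=
  exists (v : H) (C : 'I_s + 'I_t -> seq H),
  [/\ forall k, uniq (C k) /\ v \in C k,
      forall i, size (C (inl i)) = 3,
      forall j, odd (size (C (inr j))) /\ 5 <= size (C (inr j)),
      forall k l x, k != l -> x \in C k -> x \in C l -> x = v
    & (forall x, exists k, x \in C k) /\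
      edges H = \bigcup_k cycle_edges (C k)].

(* Main.v *)
Require Import Defs.
From mathcomp Require Import all_boot zify.

(** Let [k = s + t] and suppose that a coloring has more than [t2 n + (k - 2)^2 + 1] colors but no
    rainbow copy of [H].

    On a smallest vertex set [U] that keeps the surplus of colors over the Turan number, at least
    half of [#|U|] colors disappear with each vertex, so a graph [G] with one edge of each color
    has minimum degree about [#|U| / 2]. As [G] contains no copy of [H], it has an independent set
    of size about [#|U| / 2], and from this it follows that [G] is complete between two sets [A]
    and [B] up to bounded degree.

    Let [J] represent the colors not used between [A] and [B]; then [#|J|] is at least
    [(k - 2)^2 + 2] plus the number [mu] of pairs of [A * B] not needed to represent a color. A
    rainbow copy of [H] centred at [v] in [A] is obtained from [k] edges: edges at [v] in [A] and
    disjoint edges in [B] joined to [v] fit into cycles of any odd length, and one other edge fits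
    into a cycle of length at least 5. By pigeonhole, some color is carried by many disjoint edges
    in [A], and some color by many disjoint edges in [B]. If these colors differ, they supply two
    of the [k] edges, and otherwise one. The remaining edges exist in [J] because a graph without
    them has less than [(k - 2)^2 + mu], respectively at most [(k - 2)^2 + mu] edges. This is
    proved with the bound [2 * #|J_A| <= \sum_v W v * deg v + 2 * nu], where [nu] is the matching
    number and [W] takes the values 0, 1, 2 and has sum [2 * nu]. *)

Set Implicit Arguments.
Unset Strict Implicit.
Unset Printing Implicit Defensive.

(** * Paths and flowers *)

Section Basics.
Variable T : finType.
Implicit Types (E : {set {set T}}) (A B S U : {set T}) (x y z v : T).

Definition pairs U : {set {set T}} := [set e : {set T} | (e \subset U) && (#|e| == 2)].

Definition adj E : rel T := fun x y => [set x; y] \in E.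

Definition nb E x : {set T} := [set y | adj E x y].

Lemma adjC E x y : adj E x y = adj E y x.
Proof. by rewrite /adj setUC. Qed.

Lemma in_nb E x y : (y \in nb E x) = adj E x y.
Proof. by rewrite inE. Qed.

Lemma adjW E E' : E \subset E' -> subrel (adj E) (adj E').
Proof. by move=> /subsetP sub x y /sub. Qed.

Lemma nbS E E' x : E \subset E' -> nb E x \subset nb E' x.
Proof. by move=> sub; apply/subsetP => y; rewrite !in_nb; apply: adjW. Qed.

Lemma adj_pairs U E x y :
  E \subset pairs U -> adj E x y -> [/\ x \in U, y \in U & x != y].
Proof.
move=> /subsetP sub /sub; rewrite inE cards2 => /andP[/subsetP sU].
by case: (x =P y) => // _ _; rewrite !sU // !inE eqxx ?orbT.
Qed.

Lemma pairsP U (e : {set T}) :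
  reflect (exists x y, [/\ x \in U, y \in U, x != y & e = [set x; y]]) (e \in pairs U).
Proof.
apply: (iffP idP) => [|[x [y [xU yU xy ->]]]].
  rewrite inE => /andP[/subsetP sU /cards2P[x [y [xy eE]]]]; exists x, y; split=> //.
    by apply: sU; rewrite eE !inE eqxx.
  by apply: sU; rewrite eE !inE eqxx orbT.
rewrite inE cards2 xy eqxx andbT.
by apply/subsetP => u; rewrite !inE => /orP[]/eqP->.
Qed.

Lemma pick_notin A S : #|S| < #|A| -> exists2 x, x \in A & x \notin S.
Proof.
move=> lt; have /subsetPn[x xA xS] : ~~ (A \subset S).
  by apply: contraTN lt => /subset_leq_card; rewrite -leqNgt.
by exists x.
Qed.

Lemma cardU_le A B : #|A :|: B| <= #|A| + #|B|.
Proof. by rewrite cardsU leq_subr. Qed.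

Lemma card_set_seq (s : seq T) : #|[set x in s]| <= size s.
Proof. by rewrite cardsE card_size. Qed.

(* A path from [z] to [v] with [L] inner vertices can be found outside any small set [S]. *)
Definition conn E N z v (L : nat) : Prop :=
  forall S, #|S| + L <= N ->
  exists q : seq T, [/\ size q = L, path (adj E) z (rcons q v), uniq q &
                        all [predC S] q].

(* Cycles of lengths [ls] through the common vertex [v], given by their other vertices. *)
Definition flower E v (ls : seq nat) : Prop :=
  exists ds : seq (seq T),
    [/\ [seq (size d).+1 | d <- ds] = ls,
        all (fun d => path (adj E) v (rcons d v)) ds &
        uniq (v :: flatten ds)].

(* [v :: p] is the beginning of a cycle through [v] that closes up to any odd length [l >= m]. *)
Definition stem E N v (m : nat) (p : seq T) : Prop :=
  path (adj E) v p /\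
  forall l, odd l -> m <= l -> size p < l /\ conn E N (last v p) v (l.-1 - size p).

Lemma leq_stem E N v m m' p : m <= m' -> stem E N v m p -> stem E N v m' p.
Proof.
by move=> mm' [pp st]; split=> // l ol m'l; apply: st ol (leq_trans mm' m'l).
Qed.

(** The stems are closed greedily, and [S] collects the vertices to avoid. The induction closes the
    other stems away from [p], and [p] is closed last, away from all of them. The sum of the lengths
    keeps the avoided sets small enough for [conn]. *)
Lemma flower_of_stems_aux E N v (ls : seq nat) (ps : seq (seq T)) S :
  all odd ls -> size ps = size ls ->
  (forall i, i < size ls -> exists2 m, m <= nth 0 ls i & stem E N v m (nth [::] ps i)) ->
  uniq (flatten ps) -> all [predC S] (flatten ps) ->
  #|S| + sumn ls <= N ->
  exists ds : seq (seq T),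
    [/\ [seq (size d).+1 | d <- ds] = ls,
        all (fun d => path (adj E) v (rcons d v)) ds,
        uniq (flatten ds) & all [predC S] (flatten ds)].
Proof.
elim: ls ps S => [|l ls IH] [|p ps] //= S; first by exists [::].
case/andP=> ol ols [szps] st; rewrite cat_uniq all_cat => /and3P[up /hasPn pps ups].
case/andP=> /allP pS /allP psS leN.
have [m ml [pathp /(_ l ol ml)[szp cn]]] := st 0 isT; rewrite ?[nth _ _ _]/= in ml pathp szp cn.
have [|||ds [szds pds uds /allP dsS]] := IH ps (S :|: [set x in p]) ols szps _ ups.
- by move=> i ilt; apply: (st i.+1).
- apply/allP => x xps; rewrite inE /= !inE negb_or (pps x xps) andbT.
  exact: psS.
- have := cardU_le S [set x in p]; have := card_set_seq p.
  move: leN szp. lia.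
have [|q [szq pq uq /allP qS]] := cn (S :|: [set x in p ++ flatten ds]).
  have szf : size (flatten ds) <= sumn ls.
    rewrite size_flatten /shape -szds; elim: (ds) => //= d ds' le.
    by apply: leq_add.
  have := cardU_le S [set x in p ++ flatten ds]; have := card_set_seq (p ++ flatten ds).
  rewrite size_cat; move: leN szp szf; lia.
have qN x : x \in q -> [/\ x \notin S, x \notin p & x \notin flatten ds].
  move=> /qS; rewrite /= !inE mem_cat !negb_or; by case/and3P.
exists ((p ++ q) :: ds); split=> /=.
- by rewrite szds size_cat szq; congr (_ :: _); move: szp; lia.
- by rewrite pds andbT rcons_cat cat_path pathp pq.
- rewrite cat_uniq uds andbT cat_uniq up uq andbT /=; apply/andP; split.
    by apply/hasPn => x /qN[].
  apply/hasPn => x xds; rewrite mem_cat negb_or; apply/andP; split.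
    by have := dsS x xds; rewrite /= !inE negb_or => /andP[].
  by apply: contraL xds => /qN[].
- rewrite !all_cat -andbA; apply/and3P; split; apply/allP => x.
  + by move/pS.
  + by move/qN=> [].
  + by move/dsS; rewrite /= !inE negb_or => /andP[].
Qed.

(** The cycle of length [l >= 5] takes the stem [p], which need not close to a triangle; the other
    stems must also serve length 3. *)
Lemma flower_of_stems E N v l (ls : seq nat) p (ps : seq (seq T)) :
  all odd (l :: ls) -> all (leq 3) ls -> 5 <= l ->
  size ps = size ls -> (sumn (l :: ls)).+1 <= N ->
  stem E N v 5 p -> {in ps, forall q, stem E N v 3 q} ->
  uniq (v :: flatten (p :: ps)) -> flower E v (l :: ls).
Proof.
move=> ol /allP ls3 l5 sz leN stp stps /=/andP[vN us].
have [||||ds [h1 h2 h3 h4]] :=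
  @flower_of_stems_aux E N v (l :: ls) (p :: ps) [set v] ol _ _ us.
- by rewrite /= sz.
- case=> [|i] /=; first by exists 5.
  rewrite ltnS => ilt; exists 3; first by apply/ls3/mem_nth.
  by apply/stps/mem_nth; rewrite sz.
- by apply/allP => x xp; rewrite /= !inE; apply: contraNN vN => /eqP <-.
- by rewrite cards1.
exists ds; split=> //=; rewrite h3 andbT; apply/negP => /(allP h4).
by rewrite /= !inE eqxx.
Qed.

(** A robust form of being complete between [A] and [B], suited to greedy paths. The two sets may
    overlap: [rich_clique_false] takes them equal, to describe a near-clique. *)
Definition rich E N A B : Prop :=
  [/\ N < #|A|, N < #|B|,
      {in A &, forall x y, N < #|nb E x :&: nb E y :&: B|} &
      {in B &, forall x y, N < #|nb E x :&: nb E y :&: A|}].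

Lemma richC E N A B : rich E N A B -> rich E N B A.
Proof. by case. Qed.

Lemma richS E E' N A B : E \subset E' -> rich E N A B -> rich E' N A B.
Proof.
move=> sub [hA hB hAB hBA]; split=> // x y xA yA.
  by apply: leq_trans (hAB x y xA yA) _; apply/subset_leq_card/setSI/setISS; apply: nbS.
by apply: leq_trans (hBA x y xA yA) _; apply/subset_leq_card/setSI/setISS; apply: nbS.
Qed.

(** Two vertices are added at a time: a fresh [z1] in [A] and a common neighbour [y] of [z] and [z1]
    in [B]. When one inner vertex is left, it is a common neighbour of [z] and [v]. *)
Lemma conn_same E N A B z v L :
  rich E N A B -> z \in A -> v \in A -> odd L -> conn E N z v L.
Proof.
move=> [hA hB hAB hBA] zA vA oL.
have [n] := ubnP L; elim: n => // n IH in L z oL zA *; rewrite ltnS => Ln S SN.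
case: L oL Ln SN => [|[|L]] //= oL Ln SN.
  have [|y] := @pick_notin (nb E z :&: nb E v :&: B) S.
    by apply: leq_trans (hAB _ _ zA vA); rewrite ltnS; move: SN; lia.
  rewrite !inE => /andP[/andP[zy vy] _] yS; exists [:: y].
  by rewrite /= zy adjC vy /= yS.
rewrite negbK in oL.
have [|z1 z1A z1S] := @pick_notin A S; first by move: hA SN; lia.
have [|y] := @pick_notin (nb E z :&: nb E z1 :&: B) (z1 |: S).
  by apply: leq_trans (hAB _ _ zA z1A); rewrite cardsU1; move: SN; lia.
rewrite !inE negb_or => /andP[/andP[zy z1y] _] /andP[yz1 yS].
have [|//|q [szq pq uq /allP qS]] := IH L z1 oL z1A _ (y |: (z1 |: S)).
  by move: Ln; lia.
  by rewrite !cardsU1; move: SN; lia.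
have qN x : x \in q -> [/\ x != y, x != z1 & x \notin S].
  by move=> /qS; rewrite /= !inE !negb_or; case/and3P.
exists [:: y, z1 & q]; split=> //=.
- by rewrite szq.
- by rewrite zy adjC z1y.
- rewrite uq inE negb_or yz1 andbT; apply/andP; split; apply/negP.
    by move=> /qN[]; rewrite eqxx.
  by move=> /qN[_]; rewrite eqxx.
- by rewrite /= yS z1S; apply/allP => x /qN[].
Qed.

(** The last inner vertex [u] is chosen first, among the neighbours of [v] in [B]; then [conn_same],
    with the sides exchanged, joins [z] to [u]. This also serves vertices [v] not yet assigned to a
    side. *)
Lemma conn_opp E N A B z v L :
  rich E N A B -> z \in B -> N < #|nb E v :&: B| -> ~~ odd L -> 0 < L ->
  conn E N z v L.
Proof.
move=> rAB zB vB; case: L => // L /=; rewrite negbK => oL _ S SN.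
have [|u] := @pick_notin (nb E v :&: B) S; first by move: SN vB; lia.
rewrite !inE => /andP[vu uB] uS.
have [|q [szq pq uq /allP qS]] := conn_same (richC rAB) zB uB oL (S := u |: S).
  by rewrite cardsU1; move: SN; lia.
exists (rcons q u); split.
- by rewrite size_rcons szq.
- by rewrite rcons_path pq last_rcons adjC.
- by rewrite rcons_uniq uq andbT; apply/negP => /qS; rewrite /= !inE eqxx.
- rewrite all_rcons /= uS; apply/allP => x /qS.
  by rewrite /= !inE negb_or => /andP[].
Qed.

Lemma conn0 E N z v : adj E z v -> conn E N z v 0.
Proof. by move=> zv S _; exists [::]; rewrite /= zv. Qed.

Lemma rich_nb E N A B v : rich E N A B -> v \in A -> N < #|nb E v :&: B|.
Proof. by case=> _ _ h _ vA; have := h v v vA vA; rewrite setIid. Qed.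

Lemma stem_star E N A B v a :
  rich E N A B -> v \in A -> a \in A -> adj E v a -> stem E N v 3 [:: a].
Proof.
move=> rAB vA aA va; split=> [|l ol l3] /=; first by rewrite va.
split; first by move: l3; lia.
by apply: conn_same rAB aA vA _; move: ol l3; lia.
Qed.

(** A triangle closes by the edge from [b'] to [v]; a longer cycle needs [l - 3] more vertices, a
    positive even number. *)
Lemma stem_triangle E N v b b' :
  (forall L, ~~ odd L -> 0 < L -> conn E N b' v L) ->
  adj E v b -> adj E b b' -> adj E v b' -> stem E N v 3 [:: b; b'].
Proof.
move=> cn vb bb' vb'; split=> [|l ol l3] /=; first by rewrite vb bb'.
split; first by move: l3; lia.
have [->|lN] := eqVneq l 3; first by apply: conn0; rewrite adjC.
by apply: cn; move: ol l3 lN; lia.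
Qed.

Lemma stem_opp E N A B v b b' :
  rich E N A B -> v \in A -> b' \in B -> adj E v b -> adj E b b' -> 
  stem E N v 5 [:: b; b'].
Proof.
move=> rAB vA b'B vb bb'; split=> [|l ol l3] /=; first by rewrite vb bb'.
split; first by move: l3; lia.
by apply: conn_opp rAB b'B (rich_nb rAB vA) _ _; move: ol l3; lia.
Qed.

(** The vertex [b] leads from [v] to the edge. There remain [l - 4] vertices, a positive odd number,
    between two vertices of [A]. *)
Lemma stem_same E N A B v b a a' :
  rich E N A B -> v \in A -> a' \in A -> adj E v b -> adj E b a -> adj E a a' ->
  stem E N v 5 [:: b; a; a'].
Proof.
move=> rAB vA a'A vb ba aa'; split=> [|l ol l3] /=; first by rewrite vb ba aa'.
split; first by move: l3; lia.
by apply: conn_same rAB a'A vA _; move: ol l3; lia.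
Qed.

End Basics.

(** * Matchings and vertex weights *)

Section Matchings.
Variable T : finType.
Implicit Types (E M J F : {set {set T}}) (A B S U : {set T}) (x y z v : T).

Definition simple E := {in E, forall e : {set T}, #|e| = 2}.

Definition matching E M := (M \subset E) && trivIset M.

Definition max_matching E M :=
  matching E M /\ forall M', matching E M' -> #|M'| <= #|M|.

Lemma max_matching_ex E : exists M, max_matching E M.
Proof.
have m0 : matching E set0 by rewrite /matching sub0set /trivIset /cover !big_set0 cards0 eqxx.
case: (arg_maxnP (fun M : {set {set T}} => #|M|) m0) => M mM maxM.
by exists M; split.
Qed.

Lemma card_cover_matching E M :
  simple E -> matching E M -> #|cover M| = 2 * #|M|.
Proof.
move=> E2 /andP[/subsetP sub /eqP <-].
rewrite (eq_bigr (fun=> 2)) => [|e /sub /E2 //].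
by rewrite sum_nat_const mulnC.
Qed.

Lemma in_cover M e x : e \in M -> x \in e -> x \in cover M.
Proof. by move=> eM xe; apply/bigcupP; exists e. Qed.

Lemma matchingU1 E M e :
  matching E M -> e \in E -> [disjoint e & cover M] -> e != set0 ->
  matching E (e |: M) /\ e \notin M.
Proof.
case/andP=> sub tM eE dis e0.
have eM : e \notin M.
  apply: contraNN e0 => eM; rewrite -subset0; apply/subsetP => x xe.
  by have := disjointFr dis xe; rewrite (in_cover eM xe).
split=> //; rewrite /matching subUset sub1set eE sub.
apply/trivIsetP => f g; rewrite !inE.
have disM f' : f' \in M -> [disjoint e & f'].
  move=> f'M; apply: disjointWr dis; exact: bigcup_sup.
case/orP=> [/eqP->|fM] /orP[/eqP->|gM] fg; rewrite ?eqxx // in fg *.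
- exact: disM.
- by rewrite disjoint_sym disM.
- by move/trivIsetP: tM; apply.
Qed.

Lemma deg_edges E v :
  simple E -> #|nb E v| = #|[set e in E | v \in e]|.
Proof.
move=> E2; have inj : {in nb E v &, injective (fun y => [set v; y])}.
  move=> y y' yv y'v /setP eq.
  have := eq y; rewrite !inE eqxx orbT => /esym/orP[]/eqP // yE.
  by move: yv; rewrite in_nb => /E2; rewrite yE cards2 eqxx.
rewrite -(card_in_imset inj); apply: eq_card => e; rewrite !inE.
apply/imsetP/andP => [[y yv ->]|[eE ve]].
  by split; [move: yv; rewrite in_nb | rewrite !inE eqxx].
have /eqP/cards2P[x [y [xy eq]]] := E2 e eE.
move: ve; rewrite eq !inE => /orP[]/eqP->.
  by exists y; rewrite ?in_nb ?/adj -?eq.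
by exists x; rewrite ?in_nb ?/adj setUC -?eq.
Qed.

Lemma handshake E :
  simple E -> \sum_v #|nb E v| = 2 * #|E|.
Proof.
move=> E2; rewrite (eq_bigr (fun v => \sum_(e in E | v \in e) 1)); last first.
  by move=> v _; rewrite deg_edges // -sum1dep_card.
rewrite (exchange_big_dep (mem E)) /=; last by move=> ? ? _ /andP[].
rewrite mulnC -sum_nat_const.
apply: eq_bigr => e eE; rewrite -(E2 e eE) -sum1_card.
by apply: eq_bigl => v; rewrite [e \in E]eE.
Qed.

Lemma sum_nb_exchange E S U :
  \sum_(u in U) #|nb E u :&: S| = \sum_(s in S) #|nb E s :&: U|.
Proof.
transitivity (\sum_(u in U) \sum_(s in S | adj E u s) 1).
  by apply: eq_bigr => u _; rewrite sum1dep_card; apply: eq_card => s; rewrite !inE andbC.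
rewrite (exchange_big_dep (mem S)) //=; last by move=> ? ? _ /andP[].
apply: eq_bigr => s sS; rewrite sum1dep_card; apply: eq_card => u.
by rewrite !inE sS /= adjC andbC.
Qed.


(* For a maximum matching [M], weights [W] with values in {0, 1, 2} and total [2 * #|M|] are found by
   repeatedly moving a matched vertex with two neighbours in the uncovered set [U] to [S]
   (weight 2) and its partner to [U] (weight 0). Any two vertices of [U] stay simultaneously
   avoidable by a maximum matching, so [U] is independent. *)
Section Weights.
Variables (E M : {set {set T}}).
Hypotheses (E2 : simple E) (maxM : max_matching E M).

(** [M'] is the part of [M] not yet dismantled. The matchings [N] must contain it, so that the next
    edge to be dismantled is present in each of them. *)
Definition uncovered_pairs U M' :=
  {in U &, forall u u', u != u' -> exists N : {set {set T}},
    [/\ matching E N, #|N| = #|M|, M' \subset N, u \notin cover N & u' \notin cover N]}.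

Lemma uncovered_indep U M' u u' :
  uncovered_pairs U M' -> u \in U -> u' \in U -> ~~ adj E u u'.
Proof.
move=> unc uU u'U; apply/negP => uu'.
have neq : u != u' by have := E2 uu'; rewrite cards2; case: eqP.
have [N [mN szN _ uN u'N]] := unc u u' uU u'U neq.
have dis : [disjoint [set u; u'] & cover N].
  rewrite disjoint_subset; apply/subsetP => x; rewrite !inE.
  by move=> /orP[]/eqP->.
have [|mN' eN] := matchingU1 mN uu' dis.
  by apply/set0Pn; exists u; rewrite !inE eqxx.
have := maxM.2 _ mN'; rewrite cardsU1 eN szN; lia.
Qed.

(** To free [y] together with [u], choose a neighbour [w] of [x] in [U] other than [u], and in a
    matching avoiding [u] and [w] replace [[set x; y]] by [[set x; w]]. *)
Lemma uncovered_swap U M' x y :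
  uncovered_pairs U M' -> [set x; y] \in M' -> x != y -> M' \subset M ->
  1 < #|nb E x :&: U| -> U :&: cover M' = set0 ->
  uncovered_pairs (y |: U) (M' :\ [set x; y]).
Proof.
move=> unc xyM' xy subM card2 dis.
have other u : u \in U -> exists N : {set {set T}},
    [/\ matching E N, #|N| = #|M|, M' :\ [set x; y] \subset N, u \notin cover N & y \notin cover N].
  move=> uU; have [|w] := @pick_notin _ (nb E x :&: U) [set u]; first by rewrite cards1.
  rewrite !inE => /andP[xw wU] wu.
  have [N [mN szN sub uN wN]] := unc u w uU wU (ltac:(by rewrite eq_sym)).
  have xyN : [set x; y] \in N by apply: (subsetP sub).
  have cov := coverD1 (andP mN).2 xyN.
  have mN1 : matching E (N :\ [set x; y]).
    by case/andP: mN => sN tN; rewrite /matching (subset_trans (subD1set _ _) sN) trivIsetD.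
  have ux : u != x.
    apply: contraTN uU => /eqP ux; apply/negP => uU.
    by have := in_set0 u; rewrite -dis inE uU (in_cover xyM') // ux !inE eqxx.
  have wy : w != y.
    apply/negP => /eqP wy.
    by have := in_set0 w; rewrite -dis inE wU (in_cover xyM') // wy !inE eqxx orbT.
  have dis' : [disjoint [set x; w] & cover (N :\ [set x; y])].
    rewrite cov disjoint_subset; apply/subsetP => z; rewrite !inE.
    by case/orP=> /eqP->; rewrite ?eqxx // (negPf wN) andbF.
  have [|mN' eN] := matchingU1 mN1 xw dis'.
    by apply/set0Pn; exists x; rewrite !inE eqxx.
  have coverE : cover ([set x; w] |: N :\ [set x; y]) = [set x; w] :|: (cover N :\: [set x; y]).
    by rewrite /cover big_setU1 //= -[X in _ :|: X]/(cover _) cov.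
  exists ([set x; w] |: N :\ [set x; y]); split=> //.
  - by rewrite cardsU1 eN -szN (cardsD1 [set x; y] N) xyN.
  - by apply: subset_trans (subsetUr _ _); apply: setSD.
  - by rewrite coverE !inE (negPf ux) (negPf uN) andbF orbF eq_sym (negPf wu).
  - by rewrite coverE !inE eqxx orbT /= orbF negb_or eq_sym xy eq_sym.
move=> u u'; rewrite !inE => /orP[/eqP->|uU] /orP[/eqP->|u'U] uu'.
- by rewrite eqxx in uu'.
- by have [N [? ? ? ? ?]] := other u' u'U; exists N.
- by have [N [? ? ? ? ?]] := other u uU; exists N.
- have [N [mN szN sub uN u'N]] := unc u u' uU u'U uu'; exists N; split=> //.
  by apply: subset_trans sub; apply: subD1set.
Qed.

Lemma matching_weights_aux S U M' :
  M' \subset M -> S \subset cover M -> #|S| + #|M'| = #|M| ->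
  (forall x, (x \in S) + (x \in U) + (x \in cover M') = 1) ->
  uncovered_pairs U M' ->
  exists W : T -> nat,
    [/\ forall v, W v <= 2, forall v, v \notin cover M -> W v = 0,
        \sum_v W v = 2 * #|M| &
        2 * #|E| <= \sum_v W v * #|nb E v| + 2 * #|M|].
Proof.
have [n] := ubnP #|M'|; elim: n => // n IH in S U M' *.
rewrite ltnS => Mn subM subS szM part unc.
have mM' : matching E M'.
  case/andP: maxM.1 => sM tM.
  by rewrite /matching (subset_trans subM sM) (trivIsetS subM tM).
have disU : U :&: cover M' = set0.
  apply/setP => u; rewrite !inE; have := part u.
  by case: (u \in U); case: (u \in cover M'); case: (u \in S).
have [/existsP[x /andP[xM' x2]]|] := boolP [exists x, (x \in cover M') && (1 < #|nb E x :&: U|)].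
  have [e eM' xe] := bigcupP xM'.
  have [y xy eE] : exists2 y, x != y & e = [set x; y].
    have /eqP/cards2P[a [b [ab eab]]] : #|e| = 2.
      exact: (E2 (subsetP (andP mM').1 _ eM')).
    move: xe; rewrite eab !inE => /orP[]/eqP->; first by exists b.
    by exists a; rewrite 1?eq_sym // setUC.
  rewrite eE in eM'; have cov := coverD1 (andP mM').2 eM'.
  have yM' : y \in cover M' by rewrite (in_cover eM') // !inE eqxx orbT.
  have xS : x \notin S by have := part x; rewrite xM'; case: (x \in S) => //; lia.
  have szD := cardsD1 [set x; y] M'; rewrite eM' in szD.
  apply: (IH (x |: S) (y |: U) (M' :\ [set x; y])).
  - by move: Mn; rewrite szD.
  - by apply: subset_trans subM; apply: subD1set.
  - rewrite subUset subS sub1set andbT.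
    by have [f fM' xf] := bigcupP xM'; rewrite (in_cover (subsetP subM _ fM')).
  - by rewrite cardsU1 xS -szM szD /= !add1n addSnnS.
  - move=> z; have := part z; rewrite cov !inE.
    have [->|zx] := eqVneq z x; first by rewrite xM' (negPf xS) (negPf xy) /=; case: (x \in U).
    have [->|zy] := eqVneq z y; first by rewrite yM' ?orbT /=; case: (y \in S); case: (y \in U); rewrite ?orbT.
    by [].
  - exact: uncovered_swap.
rewrite negb_exists => /forallP le1.
have T1 x : x \in cover M' -> #|nb E x :&: U| <= 1.
  by move=> xM'; have := le1 x; rewrite xM' -leqNgt.
pose W x := 2 * (x \in S) + (x \in cover M').
have split_sum (f : T -> nat) : \sum_v W v * f v =
    2 * \sum_(v in S) f v + \sum_(v in cover M') f v.
  rewrite !big_distrr /= [X in _ = X + _]big_mkcond [X in _ = _ + X]big_mkcond -big_split /=.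
  apply: eq_bigr => v _; rewrite /W mulnDl.
  by case: (v \in S); case: (v \in cover M'); rewrite ?mul1n ?mul0n ?muln1 ?muln0 ?mul0n.
exists W; split.
- by move=> v; have := part v; rewrite /W; lia.
- move=> v vM; rewrite /W.
  have -> : v \in S = false by apply: contraNF vM => /(subsetP subS).
  suff -> : v \in cover M' = false by [].
  apply: contraNF vM => /bigcupP[f fM' vf].
  by rewrite (in_cover (subsetP subM _ fM')).
- rewrite (eq_bigr (fun v => W v * 1)) => [|v _]; last by rewrite muln1.
  by rewrite split_sum !sum1_card (card_cover_matching E2 mM'); lia.
(* As [U] is independent, its edges go to [S] and to [cover M']. The former are at most the degree
   sum of [S], whence the weight 2; the latter are at most one for each vertex of [cover M'], so
   [2 * #|M'|] in total. *)
rewrite -(handshake E2) split_sum.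
have -> : \sum_v #|nb E v| = \sum_(v in S) #|nb E v| + \sum_(v in U) #|nb E v|
    + \sum_(v in cover M') #|nb E v|.
  rewrite ![\sum_(v in _) _]big_mkcond -!big_split /=; apply: eq_bigr => v _.
  by have := part v; case: (v \in S); case: (v \in U); case: (v \in cover M'); rewrite ?addn0.
have -> : \sum_(v in U) #|nb E v| =
    \sum_(u in U) #|nb E u :&: S| + \sum_(u in U) #|nb E u :&: cover M'|.
  rewrite -big_split /=; apply: eq_bigr => u uU.
  rewrite -cardsUI -setIUr setICA setIA.
  have -> : nb E u :&: (S :|: cover M') = nb E u.
    apply/setIidPl/subsetP => w; rewrite in_nb => uw; have := part w.
    have wU : w \notin U by apply: contraL uw => wU; apply: uncovered_indep unc uU wU.
    by rewrite (negPf wU) inE; case: (w \in S); case: (w \in cover M').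
  rewrite [X in _ = _ + X]eq_card0 ?addn0 // => w; rewrite !inE.
  by have := part w; case: (w \in S); case: (w \in cover M'); rewrite ?andbF //; lia.
rewrite (sum_nb_exchange E S U) (sum_nb_exchange E (cover M') U).
have leS : \sum_(v in S) #|nb E v :&: U| <= \sum_(v in S) #|nb E v|.
  by apply: leq_sum => v _; rewrite subset_leq_card ?subsetIl.
have leT : \sum_(v in cover M') #|nb E v :&: U| <= #|cover M'|.
  by rewrite -sum1_card; apply: leq_sum => v vM; apply: T1.
have := card_cover_matching E2 mM'; move: leS leT szM; lia.
Qed.

Lemma matching_weights :
  exists W : T -> nat,
    [/\ forall v, W v <= 2, forall v, v \notin cover M -> W v = 0,
        \sum_v W v = 2 * #|M| &
        2 * #|E| <= \sum_v W v * #|nb E v| + 2 * #|M|].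
Proof.
apply: (@matching_weights_aux set0 (~: cover M) M) => //.
- by rewrite sub0set.
- by rewrite cards0.
- by move=> x; rewrite !inE; case: (x \in cover M).
- move=> u u'; rewrite !inE => uM u'M uu'; exists M; split=> //.
  exact: maxM.1.
Qed.

End Weights.

End Matchings.

Lemma subset_of_card (X : finType) (A : {set X}) n :
  n <= #|A| -> exists2 A' : {set X}, A' \subset A & #|A'| = n.
Proof.
elim: n => [|n IH] nA; first by exists set0; rewrite ?sub0set ?cards0.
have [A' sA cA] := IH (ltnW nA).
have [|x xA xA'] := @pick_notin _ A A'; first by rewrite cA.
by exists (x |: A'); rewrite ?subUset ?sub1set ?xA // cardsU1 xA' cA.
Qed.

(** * Weighted counts of degrees and of missing pairs *)

Section Turan.
Variable T : finType.
Implicit Types (E M J F Mt : {set {set T}}) (A B S U As W f : {set T}) (x y z v : T).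

Definition inside J A := [set e in J | e \subset A].

(** The bipartite complement of [F], as ordered pairs, so that it can be counted against
    [#|A| * #|B|]. *)
Definition mis F A B := [set p in setX A B | ~~ adj F p.1 p.2].

Lemma insideW J A e : e \in inside J A -> (e \in J) * (e \subset A).
Proof. by rewrite inE => /andP[-> ->]. Qed.

Lemma inside_simple J A : simple J -> simple (inside J A).
Proof. by move=> J2 e /insideW[/J2]. Qed.

Lemma trivIset0 : trivIset (set0 : {set {set T}}).
Proof. by rewrite /trivIset /cover !big_set0 cards0. Qed.

Lemma cover_inside J A M : matching (inside J A) M -> cover M \subset A.
Proof.
case/andP=> /subsetP sub _; apply/bigcupsP => e /sub.
by case/insideW.
Qed.

Lemma touched_card M W : trivIset M ->
  #|cover M :\: W| = \sum_(e in M) #|e :\: W|.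
Proof.
move=> tM; rewrite -sum1_card.
rewrite (eq_bigl (fun u => (u \in cover M) && (u \notin W))); last first.
  by move=> u; rewrite !inE andbC.
rewrite (@big_trivIset_cond _ _ _ _ _ (fun u => u \notin W)) //; apply: eq_bigr => e _.
by rewrite -sum1_card; apply: eq_bigl => u; rewrite !inE andbC.
Qed.

(** An edge of [M] not contained in [W] has one vertex outside [W], or two if it misses [W]
    altogether. So equality with a vertex outside forces an edge that is partly in [W]. *)
Lemma touched_matching M W : simple M -> trivIset M ->
  #|M| <= #|[set e in M | e \subset W]| + #|cover M :\: W| /\
  (0 < #|cover M :\: W| ->
   #|M| < #|[set e in M | e \subset W]| + #|cover M :\: W| \/
   exists2 f, f \in M & ~~ (f \subset W) /\ f :&: W != set0).
Proof.
move=> M2 tM; rewrite (touched_card W tM).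
have -> : \sum_(e in M) #|e :\: W| = \sum_(e in M | ~~ (e \subset W)) #|e :\: W|.
  rewrite (bigID (fun e : {set T} => e \subset W)) /= big1 ?add0n // => e /andP[_].
  by rewrite -setD_eq0 => /eqP->; rewrite cards0.
have -> : #|M| = #|[set e in M | e \subset W]| + \sum_(e in M | ~~ (e \subset W)) 1.
  rewrite -[LHS]sum1_card (bigID (fun e : {set T} => e \subset W)) /=.
  by rewrite -[#|[set e in M | _]|]sum1dep_card.
split; first rewrite leq_add2l.
  by apply: leq_sum => e /andP[_]; rewrite -setD_eq0 card_gt0.
move=> pos.
have [/existsP[f /and3P[fM fW fW0]]|] :=
  boolP [exists f, [&& f \in M, ~~ (f \subset W) & f :&: W != set0]].
  by right; exists f.
rewrite negb_exists => /forallP no; left; rewrite ltn_add2l.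
have E e : (e \in M) && ~~ (e \subset W) -> #|e :\: W| = 2.
  move=> /andP[eM eW]; have := no e; rewrite eM eW negbK => /eqP eW0.
  by rewrite -(M2 e eM) cardsD eW0 cards0 subn0.
move: pos; rewrite (eq_bigr _ E) !sum_nat_const; lia.
Qed.

(** The degree bound is summed with the weights [W]. In the two-sided applications [y] is the
    matching number of the other side and [miss v] counts the matched vertices there that are not
    joined to [v]. The form with [(miss v).-1] gains [W v] wherever [miss v] is positive. *)
Lemma side_count J A M (W miss : T -> nat) (y d0 : nat) :
  simple J -> matching (inside J A) M ->
  (forall v, v \notin cover M -> W v = 0) -> \sum_v W v = 2 * #|M| ->
  2 * #|inside J A| <= \sum_v W v * #|nb (inside J A) v| + 2 * #|M| ->
  ((forall v, v \in A -> #|nb J v| + y <= d0 + (miss v).-1) ->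
    2 * #|inside J A| + 2 * #|M| * y + \sum_(v | 0 < miss v) W v <=
    2 * #|M| * d0 + 2 * #|M| + \sum_v W v * miss v) /\
  ((forall v, v \in A -> #|nb J v| + y <= d0 + miss v) ->
    2 * #|inside J A| + 2 * #|M| * y <=
    2 * #|M| * d0 + 2 * #|M| + \sum_v W v * miss v).
Proof.
move=> J2 mM W0 sumW le.
have le' : \sum_v W v * #|nb (inside J A) v| <= \sum_v W v * #|nb J v|.
  apply: leq_sum => v _; rewrite leq_mul2l subset_leq_card ?orbT //.
  by apply: nbS; apply/subsetP => e /insideW[].
have WA v : v \notin A -> W v = 0.
  by move=> vA; apply: W0; apply: contraNN vA; apply: (subsetP (cover_inside mM)).
have key (g : T -> nat) : (forall v, v \in A -> #|nb J v| + y <= d0 + g v) ->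
  \sum_v W v * #|nb J v| + 2 * #|M| * y <= 2 * #|M| * d0 + \sum_v W v * g v.
  move=> deg; rewrite -sumW !big_distrl -!big_split /=; apply: leq_sum => v _.
  rewrite -!mulnDr leq_mul2l; have [/deg->|/WA->//] := boolP (v \in A).
  by rewrite orbT.
split=> [deg|deg]; have := key _ deg; last by move: le le'; lia.
have -> : \sum_v W v * miss v = \sum_v W v * (miss v).-1 + \sum_(v | 0 < miss v) W v.
  rewrite [X in _ = _ + X]big_mkcond -big_split; apply: eq_bigr => v _ /=.
  by case: (miss v) => [|r] /=; rewrite ?muln0 // mulnS addnC.
by move: le le'; lia.
Qed.

(** A missing pair with weights [w] and [w'] satisfies [2 * (w + w') <= 4 + w * w'], because [2 - w]
    and [2 - w'] have a nonnegative product. The terms [w * w'] are then bounded by a sum over all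
    pairs of vertices that have some missing partner. *)
Lemma miss_exchange F A B (WA WB : T -> nat) (CA CB : {set T}) :
  (forall v, WA v <= 2) -> (forall v, WB v <= 2) ->
  CA \subset A -> CB \subset B ->
  (forall v, v \notin CA -> WA v = 0) -> (forall v, v \notin CB -> WB v = 0) ->
  2 * (\sum_v WA v * #|CB :\: nb F v| + \sum_v WB v * #|CA :\: nb F v|) <=
  4 * #|mis F A B| +
  (\sum_(v | 0 < #|CB :\: nb F v|) WA v) * (\sum_(v | 0 < #|CA :\: nb F v|) WB v).
Proof.
move=> WA2 WB2 sA sB WA0 WB0.
pose P := [set p in setX CA CB | ~~ adj F p.1 p.2].
have EA : \sum_v WA v * #|CB :\: nb F v| = \sum_(p in P) WA p.1.
  rewrite (bigID (mem CA)) /= [X in _ + X]big1 ?addn0 => [|v /WA0->//].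
  rewrite (eq_bigr (fun v => \sum_(b in CB | ~~ adj F v b) WA v)) => [|v vA]; last first.
    by rewrite sum_nat_cond_const mulnC; congr (_ * _); apply: eq_card => b; rewrite !inE andbC.
  rewrite pair_big_dep /=; apply: eq_bigl => -[a b]; rewrite !inE /=.
  by rewrite andbA.
have EB : \sum_v WB v * #|CA :\: nb F v| = \sum_(p in P) WB p.2.
  rewrite (bigID (mem CB)) /= [X in _ + X]big1 ?addn0 => [|v /WB0->//].
  rewrite (eq_bigr (fun v => \sum_(a in CA | ~~ adj F a v) WB v)) => [|v vA]; last first.
    rewrite sum_nat_cond_const mulnC; congr (_ * _); apply: eq_card => b.
    by rewrite !inE adjC andbC.
  rewrite (exchange_big_dep (mem CA)) /=; last by move=> ? ? _ /andP[].
  rewrite pair_big_dep /=; apply: eq_bigl => -[a b]; rewrite !inE /=.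
  by case: (a \in CA); case: (b \in CB).
rewrite EA EB.
have sP : #|P| <= #|mis F A B|.
  apply: subset_leq_card; apply/subsetP => -[a b]; rewrite !inE /=.
  by case/andP=> /andP[/(subsetP sA)-> /(subsetP sB)->].
have le1 : 2 * (\sum_(p in P) WA p.1 + \sum_(p in P) WB p.2) <=
    4 * #|P| + \sum_(p in P) WA p.1 * WB p.2.
  rewrite -big_split /= big_distrr /= -[#|P|]sum1_card [4 * _]big_distrr -big_split /=.
  apply: leq_sum => -[a b] _ /=; have := WA2 a; have := WB2 b.
  by case: (WA a) => [|[|[|?]]] //; case: (WB b) => [|[|[|?]]] //.
have le2 : \sum_(p in P) WA p.1 * WB p.2 <=
    (\sum_(v | 0 < #|CB :\: nb F v|) WA v) * (\sum_(v | 0 < #|CA :\: nb F v|) WB v).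
  rewrite big_distrlr pair_big /= [X in _ <= X]big_mkcond [X in X <= _]big_mkcond.
  apply: leq_sum => -[a b] _ /=; case: ifP => //; rewrite !inE /= => /andP[/andP[aA bB] ab].
  rewrite ifT //; apply/andP; split; rewrite card_gt0; apply/set0Pn.
    by exists b; rewrite !inE ab.
  by exists a; rewrite !inE adjC ab.
by move: sP le1 le2; lia.
Qed.

End Turan.

(** * The inner edges of a near-bipartite graph *)

Section TuranBounds.
Variable T : finType.
Implicit Types (E M J F Mt : {set {set T}}) (A B S U As W f : {set T}) (x y z v : T).

(* A centre [v] in [A], edges of [J] from [v] to [As] and pairwise disjoint edges [Mt] of [J] in
   [B], both ends of which are joined to [v] by cross edges. Each of these edges can be used in a
   cycle through [v] of any odd length. *)
Definition fan J F A B v As Mt : Prop :=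
  [/\ v \in A, As \subset nb J v, Mt \subset inside J B, trivIset Mt &
      {in Mt, forall e : {set T}, e \subset nb F v}].

(** The bound [2 * m] is the number of vertices of [m] disjoint edges in [B]; the vertex [v] will be
    a centre joined to all of them and lying off the edge [f]. *)
Definition generic F A B m : Prop :=
  forall W f, W \subset B -> #|W| <= 2 * m -> #|f| <= 2 ->
  exists v, [/\ v \in A, v \notin f & W \subset nb F v].

(** Here [m] is the number of flexible edges that, with the edges of popular colors, would complete
    a rainbow flower: [s + t - 1] for one popular color and [s + t - 2] for two. *)
Definition no_flex J F A B m : Prop :=
  forall v As Mt, fan J F A B v As Mt -> #|As| + #|Mt| < m.

(* The further edge [f] can only be used in a cycle of length at least 5. *)
Definition no_long J F A B m : Prop :=
  forall v As Mt f, fan J F A B v As Mt ->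
  f \in inside J A /\ v \notin f /\ [disjoint As & f] \/
  [/\ f \in inside J B, f :&: nb F v != set0 & [disjoint f & cover Mt]] ->
  (#|As| + #|Mt|).+1 < m.

Lemma generic_fan J F A B m M f r : simple J ->
  generic F A B m -> matching (inside J B) M -> r <= m -> r <= #|M| -> #|f| <= 2 ->
  exists v Mt, [/\ fan J F A B v set0 Mt, #|Mt| = r & v \notin f].
Proof.
move=> J2 gen mM rm /subset_of_card[Mt sMt szMt] f2; rewrite -szMt in rm *.
have mMt : matching (inside J B) Mt.
  case/andP: mM => sM tM.
  by rewrite /matching (subset_trans sMt sM) (trivIsetS sMt tM).
have [|v [vA vf sub]] := gen (cover Mt) f (cover_inside mMt) _ f2.
  by rewrite (card_cover_matching (inside_simple (A := B) J2) mMt) leq_mul2l rm.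
exists v, Mt; split=> //; case/andP: mMt => sMt' tMt.
split; rewrite ?sub0set // => e eMt.
by apply: subset_trans sub; apply: bigcup_sup.
Qed.

Lemma full_fan J F A B M v : v \in A -> matching (inside J B) M ->
  fan J F A B v (nb J v) [set e in M | e \subset nb F v].
Proof.
move=> vA /andP[sM tM]; split=> //.
- by apply: subset_trans sM; apply/subsetP => e; rewrite inE => /andP[].
- by apply: trivIsetS tM; apply/subsetP => e; rewrite inE => /andP[].
- by move=> e; rewrite inE => /andP[].
Qed.

(** The largest fan at [v] consists of [nb J v] and the edges of [M] completely joined to [v]. Every
    other edge of [M] has a vertex not joined to [v]. *)
Lemma flex_deg J F A B m M v : simple J ->
  no_flex J F A B m -> matching (inside J B) M -> v \in A ->
  #|nb J v| + #|M| <= m.-1 + #|cover M :\: nb F v|.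
Proof.
move=> J2 no mM vA; have := no _ _ _ (full_fan F vA mM).
have M2 : simple M.
  by move=> e eM; apply: (inside_simple (A := B) J2); case/andP: mM => /subsetP sub _; apply: sub.
have [le _] := touched_matching (nb F v) M2 (andP mM).2.
by move: le; lia.
Qed.

(** This gains one over [flex_deg] if some vertex of [cover M] is not joined to [v]: either the
    count of [touched_matching] is strict, or an edge of [M] partly joined to [v] serves as the long
    edge. *)
Lemma long_deg J F A B m M v : simple J ->
  no_flex J F A B m -> no_long J F A B m -> matching (inside J B) M -> v \in A ->
  #|nb J v| + #|M| <= m.-1 + #|cover M :\: nb F v|.-1.
Proof.
move=> J2 no nol mM vA; have fanv := full_fan F vA mM.
have M2 : simple M.
  by move=> e eM; apply: (inside_simple (A := B) J2); case/andP: mM => /subsetP sub _; apply: sub.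
have [le strict] := touched_matching (nb F v) M2 (andP mM).2.
have lt := no _ _ _ fanv.
have [eq0|pos] := posnP #|cover M :\: nb F v|; first by move: le lt; rewrite eq0; lia.
have [lt'|[f fM [fN f0]]] := strict pos; first by move: lt lt'; lia.
suff : (#|nb J v| + #|[set e in M | e \subset nb F v]|).+1 < m by move: le; lia.
apply: (nol v _ _ f fanv); right; case/andP: mM => sM tM; split=> //.
  exact: (subsetP sM).
rewrite disjoint_sym disjoint_subset; apply/subsetP => u /bigcupP[e].
rewrite inE => /andP[eM eN] ue; rewrite inE.
have ef : e != f by apply: contraNneq fN => <-.
by move/trivIsetP/(_ e f eM fM ef)/disjointFr: tM => ->.
Qed.

Lemma inside_cover J A B : (forall e, e \in J -> e \subset A \/ e \subset B) ->
  #|J| <= #|inside J A| + #|inside J B|.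
Proof.
move=> Jin; apply: leq_trans (cardU_le _ _); apply: subset_leq_card.
by apply/subsetP => e eJ; rewrite !inE eJ; case: (Jin e eJ) => ->; rewrite ?orbT.
Qed.

(** Here [x] and [y] are the matching numbers of the two sides. Adding the two degree bounds and
    using [al * be <= 4 * x * y] gives [e + x * y <= m * (x + y) + mu]; then the product of [m - x]
    and [m - y] being positive suffices. *)
Lemma flex_bound (m x y e mu al be thA thB eA eB : nat) :
  x < m -> y < m -> e <= eA + eB ->
  be <= 2 * y -> al <= 2 * x -> 2 * (thA + thB) <= 4 * mu + al * be ->
  2 * eB + 2 * y * x <= 2 * y * m.-1 + 2 * y + thB ->
  2 * eA + 2 * x * y <= 2 * x * m.-1 + 2 * x + thA ->
  e < m ^ 2 + mu.
Proof.
case: m => // m xm ym le be_le al_le ex hB hA; rewrite /= in hB hA.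
have alb : al * be <= (2 * x) * (2 * y) by apply: leq_mul.
have main : e + x * y <= m.+1 * (x + y) + mu by move: le ex hB hA alb; lia.
have [p mp] : exists p, m = x + p by exists (m - x); lia.
have [q mq] : exists q, m = y + q by exists (m - y); lia.
have : m.+1 * (x + y) < m.+1 * m.+1 + x * y by nia.
by rewrite expnS expn1; move: main; lia.
Qed.

(* The weights of the two sides pair up through [w + w' <= 2 + w * w' / 2] on [0, 2]. *)
Lemma turan_flex J F A B m : simple J ->
  (forall e, e \in J -> e \subset A \/ e \subset B) ->
  generic F A B m -> generic F B A m ->
  no_flex J F A B m -> no_flex J F B A m ->
  #|J| < m ^ 2 + #|mis F A B|.
Proof.
move=> J2 Jin genA genB noA noB.
have [MA maxA] := max_matching_ex (inside J A).
have [MB maxB] := max_matching_ex (inside J B).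
have [WA [WA2 WA0 sumA leA]] := matching_weights (inside_simple J2) maxA.
have [WB [WB2 WB0 sumB leB]] := matching_weights (inside_simple J2) maxB.
have bound A' B' M : generic F A' B' m -> no_flex J F A' B' m ->
    max_matching (inside J B') M -> #|M| < m.
  move=> gen no maxM; rewrite ltnNge; apply/negP => mM.
  have [|v [Mt [fanv szMt _]]] := generic_fan (f := set0) J2 gen maxM.1 (leqnn m) mM.
    by rewrite cards0.
  by have := no _ _ _ fanv; rewrite szMt cards0 ltnn.
have x_lt := bound _ _ _ genB noB maxA.
have y_lt := bound _ _ _ genA noA maxB.
have hA := (side_count _ _ _ J2 maxA.1 WA0 sumA leA).2 (fun v vA => flex_deg J2 noA maxB.1 vA).
have hB := (side_count _ _ _ J2 maxB.1 WB0 sumB leB).2 (fun v vB => flex_deg J2 noB maxA.1 vB).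
have ex := miss_exchange F WA2 WB2 (cover_inside maxA.1) (cover_inside maxB.1) WA0 WB0.
have al_le : \sum_(v | 0 < #|cover MB :\: nb F v|) WA v <= 2 * #|MA|.
  by rewrite -sumA [X in _ <= X](bigID (fun v => 0 < #|cover MB :\: nb F v|)) leq_addr.
have be_le : \sum_(v | 0 < #|cover MA :\: nb F v|) WB v <= 2 * #|MB|.
  by rewrite -sumB [X in _ <= X](bigID (fun v => 0 < #|cover MA :\: nb F v|)) leq_addr.
exact: (flex_bound x_lt y_lt (inside_cover Jin) be_le al_le ex hB hA).
Qed.

(** Up to the constant 4, [a * b - 2 * a - 2 * b] is the product of [a - 2] and [b - 2]. If both
    factors are positive, the product grows with [a] and [b] and is largest at [2 * x] and
    [2 * y]. *)
Lemma corner_bound (a b x y : nat) : a <= 2 * x -> b <= 2 * y -> 0 < x -> 0 < y ->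
  a * b <= 2 * a + 2 * b \/ a * b + 4 * x + 4 * y <= 4 * (x * y) + 2 * a + 2 * b.
Proof.
move=> ax bY x0 y0; case: (leqP a 2) => a2; first by left; nia.
case: (leqP b 2) => b2; first by left; nia.
right; have [p pE] : exists p, 2 * x = a + p by exists (2 * x - a); lia.
have [q qE] : exists q, 2 * y = b + q by exists (2 * y - b); lia.
by nia.
Qed.

(** In the second case of [corner_bound] it suffices that [m - 1 - x] and [m - 1 - y] have a
    nonnegative product. In the first, [m * (x + y) <= m.-1 ^ 2 + 2 * (x * y)] is needed; it is
    linear in each variable and holds at the corners of the range from 1 to [m - 2]. *)
Lemma two_sided_bound (m x y e mu al be thA thB eA eB : nat) :
  0 < x -> 0 < y -> x.+1 < m -> y.+1 < m -> e <= eA + eB ->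
  be <= 2 * y -> al <= 2 * x -> 2 * (thA + thB) <= 4 * mu + al * be ->
  2 * eB + 2 * y * x + be <= 2 * y * m.-1 + 2 * y + thB ->
  2 * eA + 2 * x * y + al <= 2 * x * m.-1 + 2 * x + thA ->
  e <= m.-1 ^ 2 + mu.
Proof.
case: m => [|[|m]] //= x0 y0 xm ym le be_le al_le ex hB hA.
have [p mp] : exists p, m = x + p by exists (m - x); lia.
have [q mq] : exists q, m = y + q by exists (m - y); lia.
have main : 4 * e + 8 * (x * y) + 2 * al + 2 * be <=
    4 * (m.+2 * (x + y)) + 4 * mu + al * be by move: le ex hB hA; lia.
rewrite expnS expn1.
have [small|big] := corner_bound al_le be_le x0 y0.
  have : m.+2 * (x + y) <= m.+1 * m.+1 + 2 * (x * y).
    have [x' xE] : exists x' : nat, x = x'.+1 by exists x.-1; lia.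
    have [y' yE] : exists y' : nat, y = y'.+1 by exists y.-1; lia.
    by subst x y; nia.
  by move: main small; lia.
have : m.+1 * (x + y) <= m.+1 * m.+1 + x * y by nia.
by move: main big; lia.
Qed.

(* If some vertex has degree [m - 1], its neighbourhood meets every edge of its side. *)
Lemma one_sided_bound J F A B m M : simple J -> matching (inside J A) M ->
  #|M| < m -> max_matching (inside J A) M ->
  no_flex J F A B m -> no_long J F A B m -> [disjoint A & B] ->
  (forall e, e \in J -> e \subset A \/ e \subset B) ->
  #|inside J A| <= m.-1 ^ 2.
Proof.
move=> J2 mM Mm maxM no nol dAB Jin.
have fan0 v : v \in A -> fan J F A B v (nb J v) set0.
  by move=> vA; split; rewrite ?sub0set ?trivIset0 // => e; rewrite inE.
have degA v : v \in A -> #|nb J v| < m.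
  by move=> /fan0/no; rewrite cards0 addn0.
have nbA v w : v \in A -> w \in nb J v -> w \in A.
  move=> vA; rewrite in_nb => vw; case: (Jin _ vw) => /subsetP sub.
    by apply: sub; rewrite !inE eqxx orbT.
  by have := disjointFr dAB vA; rewrite sub // !inE eqxx.
have [/existsP[v /andP[vA dv]]|] := boolP [exists v, (v \in A) && (m.-1 <= #|nb J v|)].
  have meet e : e \in inside J A -> exists2 a, a \in nb J v & a \in e.
    move=> eJA; have [eJ eA] := insideW eJA.
    have [ve|ve] := boolP (v \in e).
      have /eqP/cards2P[a [b [ab eE]]] := J2 e eJ.
      move: ve; rewrite eE !inE => /orP[]/eqP vE.
        by exists b; [rewrite in_nb /adj vE -eE | rewrite !inE eqxx orbT].
      by exists a; [rewrite in_nb /adj vE setUC -eE | rewrite !inE eqxx].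
    have [dis|] := boolP [disjoint nb J v & e].
      have := nol v _ _ e (fan0 v vA) (or_introl (conj eJA (conj ve dis))).
      by rewrite cards0; move: dv; lia.
    by rewrite disjoint_subset => /subsetPn[a av]; rewrite !inE negbK; exists a.
  (* All edges inside [A] are counted at the vertices of [nb J v]: at most [m - 1] vertices, each of
     degree at most [m - 1]. *)
  apply: (@leq_trans (\sum_(a in nb J v) #|nb J a|)).
    rewrite -[#|inside J A|]sum1_card.
    apply: (@leq_trans (\sum_(e in inside J A) \sum_(a in nb J v | a \in e) 1)).
      apply: leq_sum => e /meet[a av ae].
      by rewrite (bigD1 a) ?av // leq_addr.
    rewrite (exchange_big_dep (mem (nb J v))) /=; last by move=> ? ? _ /andP[].
    apply: leq_sum => a av; rewrite deg_edges // sum1dep_card.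
    apply: subset_leq_card; apply/subsetP => e; rewrite !inE.
    by case/andP=> /andP[-> _] /andP[_ ->].
  apply: (@leq_trans (#|nb J v| * m.-1)).
    rewrite -sum_nat_const; apply: leq_sum => a /(nbA v _ vA)/degA; lia.
  by rewrite expnS expn1 leq_mul2r; have := degA v vA; case: (m) => //= r; rewrite ltnS => ->; rewrite orbT.
rewrite negb_exists => /forallP small.
(* Now all degrees in [A] are at most [m - 2], and the weights give at most [#|M| * (m - 1)]
   edges. *)
have [W [W2 W0 sumW le]] := matching_weights (inside_simple J2) maxM.
have := (side_count (fun=> 0) 0 m.-2 J2 mM W0 sumW le).2.
have -> : \sum_v W v * 0 = 0 by rewrite big1 // => v _; rewrite muln0.
rewrite !addn0 !muln0 addn0 => bnd.
have : 2 * #|inside J A| <= 2 * #|M| * m.-2 + 2 * #|M|.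
  apply: bnd => v vA; have := small v; rewrite vA /= -ltnNge !addn0; lia.
case: (m) Mm => [|[|r]] //= Mr; first by move: Mr; rewrite ltnS leqn0 => /eqP->; lia.
by rewrite expnS expn1; nia.
Qed.

(** If one side contains no edge of [J], [one_sided_bound] treats the other. Otherwise an edge of
    one side is the long edge beside a matching of the other, so both matching numbers are at most
    [m - 2], as [two_sided_bound] requires. *)
Lemma turan_long J F A B m : simple J -> [disjoint A & B] ->
  (forall e, e \in J -> e \subset A \/ e \subset B) ->
  generic F A B m -> generic F B A m ->
  no_flex J F A B m -> no_flex J F B A m ->
  no_long J F A B m -> no_long J F B A m ->
  #|J| <= m.-1 ^ 2 + #|mis F A B|.
Proof.
move=> J2 dAB Jin genA genB noA noB nolA nolB.
have Jin' e : e \in J -> e \subset B \/ e \subset A by move/Jin; tauto.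
have [MA maxA] := max_matching_ex (inside J A).
have [MB maxB] := max_matching_ex (inside J B).
have bound A' B' M : generic F A' B' m -> no_flex J F A' B' m ->
    max_matching (inside J B') M -> #|M| < m.
  move=> gen no maxM; rewrite ltnNge; apply/negP => mM.
  have [|v [Mt [fanv szMt _]]] := generic_fan (f := set0) J2 gen maxM.1 (leqnn m) mM.
    by rewrite cards0.
  by have := no _ _ _ fanv; rewrite szMt cards0 ltnn.
have x_lt := bound _ _ _ genB noB maxA.
have y_lt := bound _ _ _ genA noA maxB.
have empty A' M : max_matching (inside J A') M -> #|M| = 0 -> #|inside J A'| = 0.
  move=> maxM M0; apply/eqP; rewrite cards_eq0 -subset0; apply/subsetP => e eJ.
  have m1 : matching (inside J A') [set e] by rewrite /matching sub1set eJ trivIset1.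
  by have := maxM.2 _ m1; rewrite M0 cards1.
have [y0|y0] := posnP #|MB|.
  have := one_sided_bound J2 maxA.1 x_lt maxA noA nolA dAB Jin.
  have := inside_cover Jin; rewrite (empty _ _ maxB y0); lia.
have [x0|x0] := posnP #|MA|.
  have := one_sided_bound J2 maxB.1 y_lt maxB noB nolB _ Jin'.
  rewrite disjoint_sym => /(_ dAB).
  have := inside_cover Jin; rewrite (empty _ _ maxA x0); lia.
have bound2 A' B' M M' : generic F A' B' m -> no_long J F A' B' m ->
    max_matching (inside J A') M' -> 0 < #|M'| ->
    max_matching (inside J B') M -> #|M| < m -> #|M|.+1 < m.
  move=> gen nol maxM' M'0 maxM Mm; rewrite ltn_neqAle Mm andbT; apply/negP => /eqP mM.
  have [f fM'] : exists f, f \in M' by apply/set0Pn; rewrite -card_gt0.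
  have fJ : f \in inside J A' by apply: (subsetP (andP maxM'.1).1).
  have [|v [Mt [fanv szMt vf]]] :=
    generic_fan (f := f) J2 gen maxM.1 (ltnW Mm) (leqnn _).
    by rewrite (J2 f) //; case/insideW: fJ.
  have := nol v _ _ f fanv (or_introl (conj fJ (conj vf _))).
  by rewrite szMt cards0 add0n mM ltnn -setI_eq0 set0I eqxx => /(_ isT).
have x_lt2 := bound2 _ _ _ _ genB nolB maxB y0 maxA x_lt.
have y_lt2 := bound2 _ _ _ _ genA nolA maxA x0 maxB y_lt.
have [WA [WA2 WA0 sumA leA]] := matching_weights (inside_simple J2) maxA.
have [WB [WB2 WB0 sumB leB]] := matching_weights (inside_simple J2) maxB.
have hA := (side_count _ _ _ J2 maxA.1 WA0 sumA leA).1 (fun v vA => long_deg J2 noA nolA maxB.1 vA).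
have hB := (side_count _ _ _ J2 maxB.1 WB0 sumB leB).1 (fun v vB => long_deg J2 noB nolB maxA.1 vB).
have ex := miss_exchange F WA2 WB2 (cover_inside maxA.1) (cover_inside maxB.1) WA0 WB0.
have al_le : \sum_(v | 0 < #|cover MB :\: nb F v|) WA v <= 2 * #|MA|.
  by rewrite -sumA [X in _ <= X](bigID (fun v => 0 < #|cover MB :\: nb F v|)) leq_addr.
have be_le : \sum_(v | 0 < #|cover MA :\: nb F v|) WB v <= 2 * #|MB|.
  by rewrite -sumB [X in _ <= X](bigID (fun v => 0 < #|cover MA :\: nb F v|)) leq_addr.
exact: (two_sided_bound x0 y0 x_lt2 y_lt2 (inside_cover Jin) be_le al_le ex hB hA).
Qed.

End TuranBounds.

(** * Dense graphs without a flower are nearly bipartite *)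

Lemma size_le_sumn l ls N : all (leq 3) ls -> 5 <= l ->
  (sumn (l :: ls)).+1 <= N -> (size ls).+1 <= N.
Proof.
move=> ls3 l5; apply: leq_trans; rewrite /= ltnS.
suff : size ls <= sumn ls by move: l5; lia.
by elim: ls ls3 => //= a s IH /andP[a3 /IH]; move: a3; lia.
Qed.

Section Stems.
Variable T : finType.
Implicit Types (E M J F Mt : {set {set T}}) (A B S U As W f D : {set T}) (x y z v : T).

Lemma simple_pairs E U : E \subset pairs U -> simple E.
Proof. by move=> /subsetP sub e /sub; rewrite inE => /andP[_ /eqP]. Qed.

Lemma nb_pairs E U v : E \subset pairs U -> nb E v \subset U.
Proof. by move=> sub; apply/subsetP => w; rewrite in_nb => /(adj_pairs sub)[]. Qed.

Lemma mem_flatten_enum (s : seq {set T}) x :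
  (x \in flatten [seq enum e | e : {set T} <- s]) = has (fun e : {set T} => x \in e) s.
Proof.
by elim: s => //= e s IH; rewrite mem_cat IH mem_enum.
Qed.

Lemma flatten_enum_mem M x :
  (x \in flatten [seq enum e | e : {set T} <- enum M]) = (x \in cover M).
Proof.
rewrite mem_flatten_enum; apply/hasP/bigcupP => -[e eM xe]; exists e => //.
  by rewrite mem_enum in eM.
by rewrite mem_enum.
Qed.

Lemma flatten_enum_uniq M : trivIset M ->
  uniq (flatten [seq enum e | e : {set T} <- enum M]).
Proof.
move=> /trivIsetP tM; have : uniq (enum M) by apply: enum_uniq.
have : {subset enum M <= M} by move=> e; rewrite mem_enum.
elim: (enum M) => //= e s IH sub /andP[es us].
rewrite cat_uniq enum_uniq IH ?andbT //=; last by move=> f fs; apply: sub; rewrite inE fs orbT.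
apply/hasPn => x; rewrite mem_flatten_enum => /hasP[f fs xf].
have ef : e != f by apply: contraNneq es => ->.
have dis := tM e f (sub _ (mem_head _ _)) (sub f _) ef.
by rewrite mem_enum (disjointFl (dis _) xf) // inE fs orbT.
Qed.

Lemma edge_enum E U e : E \subset pairs U -> e \in E ->
  exists b b', [/\ enum e = [:: b; b'], b \in e, b' \in e & adj E b b'].
Proof.
move=> sub eE; have := simple_pairs sub eE; rewrite cardE.
case eq: (enum e) => [|b [|b' [|]]] // _; exists b, b'.
have be : b \in e by rewrite -mem_enum eq inE eqxx.
have b'e : b' \in e by rewrite -mem_enum eq !inE eqxx orbT.
split=> //; rewrite /adj; suff -> : [set b; b'] = e by [].
by apply/setP => x; rewrite -[x \in e]mem_enum eq !inE.
Qed.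

(** The matching is enlarged greedily; when this fails, the vertices of [D] outside it are
    independent. *)
Lemma matching_or_indep E D r : simple E ->
  (exists M, [/\ matching E M, #|M| = r & cover M \subset D]) \/
  (exists W, [/\ W \subset D, #|D| <= #|W| + 2 * r & {in W &, forall x y, ~~ adj E x y}]).
Proof.
move=> E2; elim: r => [|r [[M [mM szM sub]]|[W [sW le ind]]]].
- by left; exists set0; rewrite /matching sub0set trivIset0 cards0 /cover big_set0 sub0set.
- have [/existsP[x /existsP[y /and3P[xW yW xy]]]|no] :=
    boolP [exists x, exists y, [&& x \in D :\: cover M, y \in D :\: cover M & adj E x y]].
    left; move: xW yW; rewrite !inE => /andP[xM xD] /andP[yM yD].
    have dis : [disjoint [set x; y] & cover M].
      rewrite disjoint_subset; apply/subsetP => z; rewrite !inE.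
      by case/orP=> /eqP->.
    have [|mM' eM] := matchingU1 mM xy dis; first by apply/set0Pn; exists x; rewrite !inE eqxx.
    have covE : cover ([set x; y] |: M) = [set x; y] :|: cover M by rewrite /cover big_setU1.
    exists ([set x; y] |: M); rewrite cardsU1 eM szM covE.
    split=> //; rewrite subUset sub andbT; apply/subsetP => z; rewrite !inE.
    by case/orP=> /eqP->.
  right; exists (D :\: cover M); split; first exact: subsetDl.
    by rewrite cardsD (setIidPr sub) (card_cover_matching E2 mM) szM; lia.
  move=> x y xW yW; apply: contraNN no => xy.
  by apply/existsP; exists x; apply/existsP; exists y; rewrite xW yW.
- by right; exists W; split=> //; apply: leq_trans le _; rewrite leq_add2l leq_mul2l leqnSn.
Qed.

Lemma card_common E B x y c :
  #|B :\: nb E x| <= c -> #|B :\: nb E y| <= c ->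
  #|B| <= #|nb E x :&: nb E y :&: B| + 2 * c.
Proof.
move=> bx bY; have : B \subset (nb E x :&: nb E y :&: B) :|: ((B :\: nb E x) :|: (B :\: nb E y)).
  apply/subsetP => z zB; rewrite !inE zB /=.
  by case: (adj E x z); case: (adj E y z).
move/subset_leq_card/leq_trans/(_ (cardU_le _ _)).
by have := cardU_le (B :\: nb E x) (B :\: nb E y); move: bx bY; lia.
Qed.

Lemma sum_miss_exchange E S U :
  \sum_(u in U) #|S :\: nb E u| = \sum_(s in S) #|U :\: nb E s|.
Proof.
transitivity (\sum_(u in U) \sum_(s in S | ~~ adj E u s) 1).
  by apply: eq_bigr => u _; rewrite sum1dep_card; apply: eq_card => s; rewrite !inE andbC.
rewrite (exchange_big_dep (mem S)) //=; last by move=> ? ? _ /andP[].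
apply: eq_bigr => s sS; rewrite sum1dep_card; apply: eq_card => u.
by rewrite !inE sS /= adjC andbC.
Qed.

Section Dense.
Variables (E : {set {set T}}) (U : {set T}) (l : nat) (ls : seq nat) (N : nat).
Hypothesis leN : (sumn (l :: ls)).+1 <= N.
Hypotheses (EU : E \subset pairs U) (ol : all odd (l :: ls)).
Hypotheses (ls3 : all (leq 3) ls) (l5 : 5 <= l).
Hypothesis no_flower : forall v, ~ flower E v (l :: ls).
Hypothesis deg : forall v, v \in U -> #|U| <= 2 * #|nb E v| + 1.

Lemma flexible_flower v (ps : seq (seq T)) :
  size ps = (size ls).+1 -> {in ps, forall p, stem E N v 3 p} ->
  uniq (v :: flatten ps) -> False.
Proof.
case: ps => // p ps [sz] st us; apply: (@no_flower v).
apply: (flower_of_stems ol ls3 l5 sz leN _ _ us).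
  by apply: (@leq_stem _ _ _ _ 3) => //; apply: st; rewrite mem_head.
by move=> q qps; apply: st; rewrite inE qps orbT.
Qed.

Lemma nbNv v : v \notin nb E v.
Proof. by apply/negP; rewrite in_nb => /(adj_pairs EU)[_ _]; rewrite eqxx. Qed.

(** Each edge of [M] forms a triangle with [v], and by the hypothesis on [conn] it also fits into
    any longer odd cycle. *)
Lemma matching_flower v M : matching E M -> #|M| = (size ls).+1 ->
  cover M \subset nb E v ->
  (forall b L, b \in cover M -> ~~ odd L -> 0 < L -> conn E N b v L) -> False.
Proof.
case/andP=> sM tM szM sub cn.
apply: (@flexible_flower v [seq enum e | e : {set T} <- enum M]).
- by rewrite size_map -cardE.
- move=> p /mapP[e]; rewrite mem_enum => eM ->.
  have [b [b' [-> be b'e bb']]] := edge_enum EU (subsetP sM e eM).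
  have inn u : u \in e -> adj E v u.
    by move=> ue; rewrite -in_nb; apply: (subsetP sub); apply: in_cover eM ue.
  apply: stem_triangle (inn b be) bb' (inn b' b'e) => L.
  by apply: cn; apply: in_cover eM b'e.
- rewrite cons_uniq flatten_enum_uniq // flatten_enum_mem andbT.
  by apply: contra (nbNv v) => /(subsetP sub).
Qed.

Lemma rich_clique_false P : P != set0 -> ~ rich E N P P.
Proof.
case/set0Pn=> v vP rP.
have [|As sAs szAs] := @subset_of_card _ (nb E v :&: P) (size ls).+1.
  exact: leq_trans (size_le_sumn ls3 l5 leN) (ltnW (rich_nb rP vP)).
apply: (@flexible_flower v [seq [:: a] | a <- enum As]).
- by rewrite size_map -cardE.
- move=> p /mapP[a]; rewrite mem_enum => /(subsetP sAs).
  by rewrite !inE => /andP[va aP] ->; apply: stem_star rP vP aP va.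
- have -> : flatten [seq [:: a] | a <- enum As] = enum As by elim: (enum As) => //= a s ->.
  rewrite cons_uniq enum_uniq mem_enum andbT.
  by apply: contra (nbNv v) => /(subsetP sAs); rewrite inE => /andP[].
Qed.

Definition linked v := forall z S, z \in U -> #|S| <= N ->
  exists2 y, y \in nb E z :\: S & exists2 y', y' \in nb E v :\: S & adj E y y'.

(** Two arbitrary fresh steps from [z], possible by the minimum degree, reduce [L] by 2. The base
    case [L = 2] is [linked]. *)
Lemma linked_conn v z L : 2 * N + 2 <= #|U| -> linked v -> z \in U ->
  ~~ odd L -> 0 < L -> conn E N z v L.
Proof.
move=> Ubig lk; have [n] := ubnP L; elim: n => // n IH in L z *; rewrite ltnS.
case: L => [|[|[|[|L]]]] // Ln zU oL _ S SN.
  have [|y] := lk z S zU; first by move: SN; clear; lia.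
  rewrite !inE => /andP[yS zy] [y']; rewrite !inE => /andP[y'S vy'] yy'.
  have [_ _ yNy'] := adj_pairs EU yy'.
  by exists [:: y; y']; rewrite /= zy yy' adjC vy' inE yNy' yS y'S.
have fresh x (R : {set T}) : x \in U -> #|R| <= N -> exists2 y, y \in nb E x & y \notin R.
  by move=> xU RN; apply: pick_notin; have := deg xU; move: RN Ubig; clear; lia.
have [|y zy yS] := fresh z S zU; first by move: SN; clear; lia.
have [_ yU _] := adj_pairs EU (eq_ind _ is_true zy _ (in_nb E z y)).
have [|w yw] := fresh y (y |: S) yU; first by rewrite cardsU1; move: SN; clear; lia.
rewrite !inE negb_or => /andP[wy wS].
have [_ wU _] := adj_pairs EU (eq_ind _ is_true yw _ (in_nb E y w)).
have [||//||q [szq pq uq /allP qS]] := IH L.+2 w _ wU _ _ (w |: (y |: S)).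
- by move: Ln; clear; lia.
- by move: oL; rewrite /= !negbK.
- by rewrite !cardsU1; move: SN; clear; lia.
have qN x : x \in q -> [/\ x != w, x != y & x \notin S].
  by move=> /qS; rewrite /= !inE !negb_or; case/and3P.
exists [:: y, w & q]; split=> //=.
- by rewrite szq.
- by rewrite -in_nb zy -in_nb yw.
- rewrite uq inE negb_or eq_sym wy andbT; apply/andP; split; apply/negP.
    by move=> /qN[]; rewrite eqxx.
  by move=> /qN[]; rewrite eqxx.
- by rewrite yS wS; apply/allP => x /qN[].
Qed.

Definition indep W := {in W &, forall x y, ~~ adj E x y}.

(* If no edge joins [nb z] to [nb v], then either these neighbourhoods overlap in a large
   independent set, or they are almost disjoint and [nb z] is almost a clique. *)
Lemma unlinked_indep z v S : 8 * N + 8 <= #|U| -> z \in U -> v \in U -> #|S| <= N ->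
  (forall y y', y \in nb E z :\: S -> y' \in nb E v :\: S -> ~~ adj E y y') ->
  exists W, [/\ W \subset U, indep W & #|U| <= 2 * #|W| + 4 * N + 3].
Proof.
move=> Ubig zU vU SN no.
set P := nb E z :\: S in no *; set Q := nb E v :\: S in no *.
have PU : P \subset U by apply: subset_trans (subsetDl _ _) (nb_pairs z EU).
have QU : Q \subset U by apply: subset_trans (subsetDl _ _) (nb_pairs v EU).
have bigD x : x \in U -> #|U| <= 2 * #|nb E x :\: S| + 2 * N + 1.
  move=> xU; have := deg xU; have := cardsID S (nb E x).
  have := subset_leq_card (subsetIr (nb E x) S); move: SN; clear; lia.
have szP := bigD z zU; have szQ := bigD v vU; rewrite -/P in szP; rewrite -/Q in szQ.
have [PQ0|/set0Pn[y]] := eqVneq (P :&: Q) set0; last first.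
  case/setIP=> yP yQ; exists (P :&: Q).
  have yU := subsetP PU y yP.
  split.
  - exact: subset_trans (subsetIl _ _) PU.
  - by move=> a b /setIP[aP _] /setIP[_ bQ]; apply: no.
  (* The common vertex [y] has no neighbour in [P] or [Q], so their union fills at most about half
     of [U]. As each of them is about that large, they nearly coincide. *)
  have : #|nb E y :|: (P :|: Q)| <= #|U|.
    by apply: subset_leq_card; rewrite !subUset nb_pairs // PU QU.
  rewrite cardsU; have -> : nb E y :&: (P :|: Q) = set0.
    apply/setP => w; rewrite [RHS]inE in_setI in_setU in_nb; apply/negP => /andP[yw].
    move=> /orP[wP|wQ]; last by have := no y w yP wQ; rewrite yw.
    by have := no w y wP yQ; rewrite adjC yw.
  rewrite cards0 subn0; have := cardsUI P Q; have := deg yU; move: szP szQ; clear; lia.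
exfalso; have szPQ := cardsUI P Q; rewrite PQ0 cards0 in szPQ.
(* The disjoint sets [P] and [Q] nearly exhaust [U]. The neighbours of [y] avoid [Q], so they
   include almost all of [P]. *)
have near y : y \in P -> #|P :\: nb E y| <= N + 1.
  move=> yP; have yU := subsetP PU y yP.
  have : #|Q :|: (nb E y :|: (P :\: nb E y))| <= #|U|.
    apply: subset_leq_card; rewrite !subUset nb_pairs // QU /=.
    exact: subset_trans (subsetDl _ _) PU.
  rewrite cardsU; have -> : Q :&: (nb E y :|: (P :\: nb E y)) = set0.
    apply/setP => w; rewrite [RHS]inE in_setI in_setU in_nb in_setD.
    apply/negP => /andP[wQ /orP[yw|/andP[_ wP]]].
      by have := no y w yP wQ; rewrite yw.
    by have := in_set0 w; rewrite -PQ0 in_setI wP wQ.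
  rewrite cards0 subn0 cardsU; have -> : nb E y :&: (P :\: nb E y) = set0.
    by apply/setP => w; rewrite !inE; case: (adj E y w); rewrite ?andbF.
  by rewrite cards0 subn0; have := deg yU; move: szQ; clear; lia.
have Pbig : 3 * N + 3 <= #|P| by move: szP Ubig; clear; lia.
apply: (@rich_clique_false P).
  by rewrite -card_gt0; move: Pbig; clear; lia.
have com : {in P &, forall x y, N < #|nb E x :&: nb E y :&: P|}.
  move=> x y xP yP; have := card_common (near x xP) (near y yP); move: Pbig; clear; lia.
by split=> //; move: Pbig; clear; lia.
Qed.

(** If some vertices are not linked, [unlinked_indep] applies. Otherwise no neighbourhood contains a
    matching of [size ls + 1] edges, so almost all of a neighbourhood is independent. *)
Lemma large_indep : 8 * N + 8 <= #|U| ->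
  exists W, [/\ W \subset U, indep W & #|U| <= 2 * #|W| + 4 * N + 3].
Proof.
move=> Ubig.
have [/existsP[z /existsP[v /existsP[S /and4P[zU vU SN /forallP no]]]]|] :=
  boolP [exists z, exists v, exists S : {set T}, [&& z \in U, v \in U, #|S| <= N &
    [forall y, [forall y', (y \in nb E z :\: S) ==> (y' \in nb E v :\: S) ==> ~~ adj E y y']]]].
  apply: (unlinked_indep Ubig zU vU SN) => y y' yP y'Q.
  by have /forallP/(_ y') := no y; rewrite yP y'Q.
move=> none; have [x xU] : exists x, x \in U.
  by apply/set0Pn; rewrite -card_gt0; move: Ubig; clear; lia.
have lk : linked x.
  move=> z S zU SN; move: none; rewrite negb_exists => /forallP/(_ z).
  rewrite negb_exists => /forallP/(_ x); rewrite negb_exists => /forallP/(_ S).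
  rewrite zU xU SN /= negb_forall => /existsP[y]; rewrite negb_forall => /existsP[y'].
  rewrite negb_imply => /andP[yz]; rewrite negb_imply => /andP[y'x /negPn yy'].
  by exists y => //; exists y'.
have [[M [mM szM sub]]|[W [sW le ind]]] :=
  matching_or_indep (nb E x) (size ls).+1 (simple_pairs EU).
  exfalso; apply: (matching_flower mM szM sub) => b L bM.
  apply: linked_conn lk _; first by move: Ubig; clear; lia.
  by apply: (subsetP (nb_pairs x EU)); apply: (subsetP sub).
exists W; split=> //; first exact: subset_trans sW (nb_pairs x EU).
have := deg xU; have := (size_le_sumn ls3 l5 leN); move: le; clear; lia.
Qed.

(** The large independent set [I] is the core of [A], and its complement without a few bad vertices
    is the core [Bg] of [B]. Any vertex has few neighbours in one of the cores and is put on that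
    side; by the minimum degree it is then joined to almost all of the other side. *)
Lemma near_bipartite : 100 * N + 100 <= #|U| ->
  exists A B : {set T},
    [/\ A :|: B = U, [disjoint A & B],
        forall v, v \in A -> #|B :\: nb E v| <= 24 * N + 21,
        forall v, v \in B -> #|A :\: nb E v| <= 24 * N + 21 &
        #|U| <= 2 * #|A| + 24 * N + 21 /\ #|U| <= 2 * #|B| + 24 * N + 21].
Proof.
move=> Ubig; have [|I [IU ind szI]] := large_indep; first by move: Ubig; clear; lia.
pose B0 := U :\: I; have szB0 : #|I| + #|B0| = #|U|.
  by rewrite -(cardsID I U) (setIidPr IU).
have missI y : y \in I -> #|B0 :\: nb E y| <= 2 * N + 2.
  move=> yI; have sub : nb E y \subset B0.
    apply/subsetP => w; rewrite in_nb => yw; have [_ wU _] := adj_pairs EU yw.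
    by rewrite inE wU andbT; apply: contraL yw => wI; apply: ind.
  have := cardsD B0 (nb E y); rewrite (setIidPr sub).
  have := deg (subsetP IU y yI); move: szB0 szI; clear; lia.
pose Bb := [set w in B0 | #|I| < 4 * #|I :\: nb E w|].
pose Bg := B0 :\: Bb.
have Ipos : 0 < #|I| by move: szI Ubig; clear; lia.
(* Missing pairs between [I] and [B0] are counted twice: at most [2 * N + 2] at a vertex of [I],
   more than a quarter of [#|I|] at a vertex of [Bb]. *)
have szBb : #|Bb| <= 8 * N + 8.
  have : #|Bb| * #|I| <= 4 * (#|I| * (2 * N + 2)).
    rewrite -sum_nat_const -[#|I| * _]sum_nat_const big_distrr /=.
    apply: (@leq_trans (\sum_(w in Bb) 4 * #|I :\: nb E w|)).
      by apply: leq_sum => w; rewrite !inE => /andP[_ /ltnW].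
    apply: (@leq_trans (\sum_(w in B0) 4 * #|I :\: nb E w|)).
      rewrite [X in _ <= X](bigID (fun w => w \in Bb)) /=; apply: leq_trans (leq_addr _ _).
      rewrite leq_eqVlt (eq_bigl (fun w => (w \in B0) && (w \in Bb))) ?eqxx // => w.
      by rewrite !inE; case: (w \in U); case: (w \in I).
    rewrite -!big_distrr /= leq_mul2l /= sum_miss_exchange.
    by apply: leq_sum.
  by rewrite mulnCA [X in _ <= X]mulnC leq_pmul2r //; clear; lia.
have sBb : Bb \subset B0 by apply/subsetP => w; rewrite inE => /andP[].
have szBg : #|Bg| + #|Bb| = #|B0| by rewrite -(cardsID Bb B0) (setIidPr sBb) addnC.
have [y0 y0I] : exists y, y \in I by apply/set0Pn; rewrite -card_gt0.
have B0big : #|U| <= 2 * #|B0| + 4 * N + 5.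
  have := missI y0 y0I; have := deg (subsetP IU y0 y0I).
  have : #|nb E y0| <= #|B0|.
    apply: subset_leq_card; apply/subsetP => w; rewrite in_nb => yw.
    have [_ wU _] := adj_pairs EU yw.
    by rewrite inE wU andbT; apply: contraL yw => wI; apply: ind.
  lia.
have missIg y : y \in I -> #|Bg :\: nb E y| <= 2 * N + 2.
  move=> /missI; apply: leq_trans; apply: subset_leq_card; apply: setSD; exact: subsetDl.
have missg w : w \in Bg -> 4 * #|I :\: nb E w| <= #|I|.
  by rewrite !inE; case: (w \in U); case: (w \in I) => //=; rewrite ?andbF // andbT -leqNgt.
have rIB : rich E N I Bg.
  split.
  - by move: szI Ubig; clear; lia.
  - by move: szBg szBb B0big Ubig; clear; lia.
  - move=> y y' /missIg h /missIg h'; have := card_common h h'.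
    by move: szBg szBb B0big Ubig; clear; lia.
  - move=> w w' /missg h /missg h'.
    have hh : #|I :\: nb E w| <= #|I| %/ 4 by rewrite leq_divRL // mulnC.
    have hh' : #|I :\: nb E w'| <= #|I| %/ 4 by rewrite leq_divRL // mulnC.
    by have := card_common hh hh'; have := leq_divM #|I| 4; move: szI Ubig; clear; lia.
(* A vertex with more than [c6] neighbours in both cores has a matching in its neighbourhood or an
   independent set [W] in it that loses at most [2 * N] of them on each side. Then a vertex of [W]
   in [I] would miss more than the [2 * N + 2] vertices of [Bg] allowed by [missIg]. *)
pose c6 := 4 * N + 2.
have claim v : #|nb E v :&: I| <= c6 \/ #|nb E v :&: Bg| <= c6.
  have [|big1] := leqP #|nb E v :&: I| c6; [by left | right; rewrite leqNgt; apply/negP => big2].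
  have [[M [mM szM sub]]|[W [sW le indW]]] :=
    matching_or_indep (nb E v :&: (I :|: Bg)) (size ls).+1 (simple_pairs EU).
    apply: (matching_flower mM szM (subset_trans sub (subsetIl _ _))) => b L bM oL L0.
    have := subsetP sub b bM; rewrite in_setI in_setU => /andP[_ /orP[bI|bB]].
      by apply: conn_opp (richC rIB) bI _ oL L0; move: big1; rewrite /c6; clear; lia.
    by apply: conn_opp rIB bB _ oL L0; move: big2; rewrite /c6; clear; lia.
  have szD (X : {set T}) : X \subset nb E v :&: (I :|: Bg) -> #|X| <= #|W :&: X| + 2 * (size ls).+1.
    move=> sX; have h1 := cardsID W X; rewrite setIC in h1.
    have h2 := subset_leq_card (setSD W sX); have h3 := cardsID W (nb E v :&: (I :|: Bg)).
    by rewrite (setIidPr sW) in h3; move: h1 h2 h3 le; clear; lia.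
  have h1 := szD _ (setIS (nb E v) (subsetUl I Bg)).
  have h2 := szD _ (setIS (nb E v) (subsetUr I Bg)).
  have szl := (size_le_sumn ls3 l5 leN).
  have [p] : exists p, p \in W :&: (nb E v :&: I).
    by apply/set0Pn; rewrite -card_gt0; move: h1 big1 szl; rewrite /c6; clear; lia.
  rewrite !inE => /and3P[pW _ pI].
  have : #|W :&: (nb E v :&: Bg)| <= #|Bg :\: nb E p|.
    apply: subset_leq_card; apply/subsetP => w /setIP[wW /setIP[_ wB]].
    by rewrite in_setD wB andbT in_nb; apply: indW.
  by have := missIg p pI; move: h2 big2 szl; rewrite /c6; clear; lia.
have nb_split v : #|nb E v| <= #|nb E v :&: I| + #|nb E v :&: Bg| + #|Bb|.
  have : nb E v \subset ((nb E v :&: I) :|: (nb E v :&: Bg)) :|: Bb.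
    apply/subsetP => w vw; have wU := subsetP (nb_pairs v EU) w vw.
    rewrite !in_setU !in_setI vw /= [w \in Bg]in_setD [w \in B0]in_setD wU andbT.
    by case: (w \in I); case: (w \in Bb).
  move/subset_leq_card/leq_trans/(_ (cardU_le _ _)).
  by have := cardU_le (nb E v :&: I) (nb E v :&: Bg); clear; lia.
pose A := [set v in U | #|nb E v :&: I| <= c6].
pose B := U :\: A.
have IA : I \subset A.
  apply/subsetP => y yI; rewrite inE (subsetP IU y yI) /=.
  rewrite eq_card0 // => w; rewrite !inE; apply/negP => /andP[yw wI].
  by have := ind y w yI wI; rewrite yw.
have BgB : Bg \subset B.
  apply/subsetP => w wB; have h := missg w wB.
  have wU : w \in U by move: wB; rewrite !inE => /and3P[].
  rewrite inE wU andbT inE wU /= -ltnNge.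
  have := cardsID (nb E w) I; rewrite setIC; move: h szI Ubig; rewrite /c6; clear; lia.
have AU : A \subset U by apply/subsetP => v; rewrite inE => /andP[].
have szAB : #|A| + #|B| = #|U| by rewrite -(cardsID A U) (setIidPr AU).
have degA v : v \in A -> #|nb E v| <= #|nb E v :&: B| + 12 * N + 10.
  rewrite inE => /andP[_ small]; have := nb_split v.
  have := subset_leq_card (setIS (nb E v) BgB); move: small szBb; rewrite /c6; clear; lia.
have degB v : v \in B -> #|nb E v| <= #|nb E v :&: A| + 12 * N + 10.
  rewrite !inE => /andP[vA vU]; rewrite vU /= in vA; have := nb_split v.
  have := subset_leq_card (setIS (nb E v) IA).
  by case: (claim v) vA => [-> //|]; move: szBb; rewrite /c6; clear; lia.
have [b0 b0B] : exists b, b \in B.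
  have [|b bBg] := @pick_notin _ Bg set0.
    by rewrite cards0; move: szBg szBb B0big Ubig; clear; lia.
  by exists b; apply: (subsetP BgB).
have bigB : #|U| <= 2 * #|B| + 24 * N + 21.
  have := degA y0 (subsetP IA y0 y0I); have := deg (subsetP IU y0 y0I).
  have := subset_leq_card (subsetIr (nb E y0) B); clear; lia.
have bU : b0 \in U by move: b0B; rewrite inE => /andP[].
have bigA : #|U| <= 2 * #|A| + 24 * N + 21.
  have := degB b0 b0B; have := deg bU.
  have := subset_leq_card (subsetIr (nb E b0) A); clear; lia.
exists A, B; split=> //.
- by rewrite -[X in X :|: _](setIidPr AU) setID.
- by rewrite disjoint_sym disjoint_subset; apply/subsetP => v; rewrite !inE => /andP[].
- move=> v vA; have := degA v vA; have := deg (subsetP AU v vA).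
  by have := cardsID (nb E v) B; rewrite setIC; move: szAB bigA; clear; lia.
- move=> v vB; have vU : v \in U by move: vB; rewrite inE => /andP[].
  have := degB v vB; have := deg vU.
  by have := cardsID (nb E v) A; rewrite setIC; move: szAB bigB; clear; lia.
Qed.

End Dense.
End Stems.

(** * Flowers from fans *)

Section Assembly.
Variable T : finType.
Implicit Types (E M J F Mt P X : {set {set T}}) (A B S U As W f D : {set T}) (x y z v : T).

Lemma truncate_pair As Mt r : r <= #|As| + #|Mt| ->
  exists As' Mt', [/\ As' \subset As, Mt' \subset Mt & #|As'| + #|Mt'| = r].
Proof.
move=> le; have [|As' sA cA] := @subset_of_card _ As (minn r #|As|); first exact: geq_minr.
have [|Mt' sM cM] := @subset_of_card _ Mt (r - #|As|); first by move: le; lia.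
by exists As', Mt'; split=> //; rewrite cA cM; lia.
Qed.

Lemma fanS J F A B v As Mt As' Mt' : fan J F A B v As Mt ->
  As' \subset As -> Mt' \subset Mt -> fan J F A B v As' Mt'.
Proof.
move=> [vA sA sM tM nM] sA' sM'; split=> //.
- exact: subset_trans sA' sA.
- exact: subset_trans sM' sM.
- exact: trivIsetS sM' tM.
- by move=> e /(subsetP sM'); apply: nM.
Qed.

Lemma flatten_single (s : seq T) : flatten [seq [:: a] | a <- s] = s.
Proof. by elim: s => //= a s ->. Qed.

Section Assemble.
Variables (E : {set {set T}}) (U A B : {set T}) (l : nat) (ls : seq nat) (N : nat).
Hypothesis leN : (sumn (l :: ls)).+1 <= N.
Hypotheses (EU : E \subset pairs U) (ol : all odd (l :: ls)).
Hypotheses (ls3 : all (leq 3) ls) (l5 : 5 <= l).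
Hypotheses (dAB : [disjoint A & B]) (rAB : rich E N A B).
Variables (v : T) (As : {set T}) (Mt : {set {set T}}).
Hypotheses (vA : v \in A) (sAs : As \subset nb E v) (AsA : As \subset A).
Hypotheses (sMt : Mt \subset E) (tMt : trivIset Mt).
Hypotheses (MtB : cover Mt \subset B) (Mtv : cover Mt \subset nb E v).
Hypothesis szAM : #|As| + #|Mt| = size ls.

Let ps := [seq [:: a] | a <- enum As] ++ [seq enum e | e : {set T} <- enum Mt].

(** The [size ls] edges of [As] and [Mt] give stems for the lengths in [ls], and [p] serves the
    cycle of length [l]. *)
Lemma fan_flower p : stem E N v 5 p -> uniq p -> v \notin p ->
  {in p, forall x, x \notin As} -> {in p, forall x, x \notin cover Mt} ->
  flower E v (l :: ls).
Proof.
move=> stp up vp pAs pMt; have vAs : v \notin As.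
  apply/negP => /(subsetP sAs); rewrite in_nb => /(adj_pairs EU)[_ _].
  by rewrite eqxx.
have vMt : v \notin cover Mt.
  by apply/negP => /(subsetP MtB); rewrite (disjointFr dAB vA).
apply: (flower_of_stems (ps := ps) ol ls3 l5 _ leN stp).
- by rewrite /ps size_cat !size_map -!cardE.
- move=> q; rewrite mem_cat => /orP[] /mapP[].
    move=> a; rewrite mem_enum => aAs ->.
    by apply: stem_star rAB vA (subsetP AsA a aAs) _; rewrite -in_nb; apply: (subsetP sAs).
  move=> e; rewrite mem_enum => eMt ->.
  have [b [b' [-> be b'e bb']]] := edge_enum EU (subsetP sMt e eMt).
  have inn u : u \in e -> adj E v u.
    by move=> ue; rewrite -in_nb; apply: (subsetP Mtv); apply: in_cover eMt ue.
  apply: stem_triangle (inn b be) bb' (inn b' b'e) => L oL L0.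
  apply: conn_opp rAB _ (rich_nb rAB vA) oL L0.
  by apply: (subsetP MtB); apply: in_cover eMt b'e.
- have mem x : x \in flatten ps = (x \in As) || (x \in cover Mt).
    by rewrite /ps flatten_cat flatten_single mem_cat mem_enum flatten_enum_mem.
  rewrite cons_uniq [flatten _]/= mem_cat mem !negb_or vp vAs vMt cat_uniq up /=.
  apply/andP; split.
    apply/hasPn => x; rewrite mem => /orP[xA|xM]; apply/negP => xp.
      by have := pAs x xp; rewrite xA.
    by have := pMt x xp; rewrite xM.
  rewrite /ps flatten_cat flatten_single cat_uniq enum_uniq flatten_enum_uniq // andbT.
  apply/hasPn => x; rewrite flatten_enum_mem mem_enum => /(subsetP MtB) xB.
  by apply/negP => /(subsetP AsA) xA; rewrite (disjointFr dAB xA) in xB.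
Qed.

Lemma assemble_opp e : e \in E -> e \subset B -> e :&: nb E v != set0 ->
  [disjoint e & cover Mt] -> flower E v (l :: ls).
Proof.
move=> eE /subsetP eB /set0Pn[b]; rewrite inE in_nb => /andP[be vb] dis.
have [b' [b'e bb' eq]] : exists b', [/\ b' \in e, adj E b b' & e = [set b; b']].
  have /eqP/cards2P[x [y [xy eq]]] := simple_pairs EU eE.
  move: be; rewrite eq !inE => /orP[]/eqP bx.
    by exists y; rewrite bx /adj -eq; split=> //; rewrite eq !inE eqxx orbT.
  exists x; rewrite bx /adj setUC [[set y; x]]setUC -eq; split=> //.
  by rewrite eq !inE eqxx.
have [_ _ bNb'] := adj_pairs EU bb'.
have pe x : x \in [:: b; b'] -> x \in e.
  by rewrite !inE => /orP[]/eqP->.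
apply: (fan_flower (stem_opp rAB vA (eB b' b'e) vb bb')).
- by rewrite /= inE bNb'.
- by apply/negP => /pe/eB; rewrite (disjointFr dAB vA).
- move=> x /pe/eB xB; apply/negP => /(subsetP AsA) xA.
  by rewrite (disjointFr dAB xA) in xB.
- by move=> x /pe xe; rewrite (disjointFr dis xe).
Qed.

Lemma assemble_same e : e \in E -> e \subset A -> v \notin e ->
  [disjoint As & e] -> flower E v (l :: ls).
Proof.
move=> eE /subsetP eA ve dis.
have [a [a' [_ ae a'e aa']]] := edge_enum EU eE.
have [_ _ aNa'] := adj_pairs EU aa'.
have szMt : #|cover Mt| <= N.
  have mMt : matching E Mt by rewrite /matching sMt.
  rewrite (card_cover_matching (simple_pairs EU) mMt).
  apply: leq_trans leN; rewrite /= ltnW // ltnS.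
  apply: (@leq_trans (2 * size ls)); first by rewrite leq_mul2l -szAM leq_addl.
  apply: (@leq_trans (sumn ls)); last exact: leq_addl.
  by elim: (ls) ls3 => //= r s IH /andP[r3 /IH]; move: r3; clear; lia.
(* [b] leads from [v] to the edge [e]; the common neighbours of [v] and [a] are too many to be all
   used by [Mt]. *)
have [|b] := @pick_notin _ (nb E v :&: nb E a :&: B) (cover Mt).
  by case: rAB => _ _ h _; apply: leq_ltn_trans szMt (h v a vA (eA a ae)).
rewrite !inE => /andP[/andP[vb ab] bB] bMt; rewrite adjC in ab.
have stp := stem_same rAB vA (eA a' a'e) vb ab aa'.
have bA x : x \in A -> x != b.
  by move=> xA; apply: contraTneq bB => <-; rewrite (disjointFr dAB xA).
apply: (fan_flower stp).
- by rewrite /= !inE negb_or ![b == _]eq_sym !bA ?eA // aNa'.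
- rewrite !inE !negb_or bA //=; apply/andP; split; apply: contraNneq ve => -> //.
- move=> x; rewrite !inE => /or3P[]/eqP->.
  + by apply: contraTN bB => /(subsetP AsA)/(disjointFr dAB) ->.
  + by rewrite (disjointFl dis).
  + by rewrite (disjointFl dis).
- move=> x; rewrite !inE => /or3P[]/eqP-> //.
  + by apply: contraTN (eA a ae) => /(subsetP MtB)/(disjointFl dAB) ->.
  + by apply: contraTN (eA a' a'e) => /(subsetP MtB)/(disjointFl dAB) ->.
Qed.

End Assemble.
End Assembly.

(** * Colorings of a nearly bipartite vertex set *)

Section Coloring.
Variables (T C : finType) (c : {set T} -> C).
Implicit Types (E G M J F Mt P X : {set {set T}}) (A B S U As W f : {set T}).
Implicit Types (x y z v : T) (R : {set C}).

Definition rainbow_set E := {in E &, injective c}.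

(** Edges of new colors are added one at a time. Starting from [G0] keeps a dense graph found
    earlier within the new system of representatives. *)
Lemma rainbow_extend G0 E : G0 \subset E -> rainbow_set G0 ->
  exists G1 : {set {set T}},
    [/\ G0 \subset G1, G1 \subset E, rainbow_set G1 & c @: G1 = c @: E].
Proof.
move=> sR0 inj0; have [n] := ubnP (#|E| - #|G0|); elim: n => // n IH in G0 sR0 inj0 *.
rewrite ltnS => le; have [eq|] := eqVneq (c @: G0) (c @: E); first by exists G0.
rewrite eqEsubset imsetS //= => /subsetPn[_ /imsetP[e eE ->] ceR].
have eR : e \notin G0 by apply: contraNN ceR => eR; apply: imset_f.
have sU : e |: G0 \subset E by rewrite subUset sub1set eE.
have [||G1 [s1 s2 h3 h4]] := IH (e |: G0) sU.
- move=> x y; rewrite !inE => /orP[/eqP->|xR] /orP[/eqP->|yR] // eqc.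
  + by case/negP: ceR; rewrite eqc imset_f.
  + by case/negP: ceR; rewrite -eqc imset_f.
  + exact: inj0.
- have := subset_leq_card sU; rewrite cardsU1 eR /=; move: le; clear; move: #|E| #|G0| => a b; lia.
by exists G1; split=> //; apply: subset_trans s1; apply: subsetUr.
Qed.

Lemma rainbowU E X R : rainbow_set E -> rainbow_set X ->
  (forall e, e \in E -> c e \notin R) -> (forall e, e \in X -> c e \in R) ->
  rainbow_set (E :|: X).
Proof.
move=> rE rX ER XR e f; rewrite !inE => /orP[eE|eX] /orP[fE|fX] eq.
- exact: rE.
- by have := ER e eE; rewrite eq XR.
- by have := ER f fE; rewrite -eq XR.
- exact: rX.
Qed.

Lemma rainbowS E E' : E \subset E' -> rainbow_set E' -> rainbow_set E.
Proof. by move=> /subsetP sub rE e f /sub eE /sub fE; apply: rE. Qed.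

Section Final.
Variables (U : {set T}) (l : nat) (ls : seq nat) (N D : nat).
Hypothesis leN : (sumn (l :: ls)).+1 <= N.
Hypotheses (ol : all odd (l :: ls)) (ls3 : all (leq 3) ls) (l5 : 5 <= l).
Hypothesis ls_gt0 : 0 < size ls.
Hypothesis no_flower : forall E v,
  E \subset pairs U -> rainbow_set E -> ~ flower E v (l :: ls).

Lemma size_ltN : (size ls).+1 <= N.
Proof. exact: size_le_sumn ls3 l5 leN. Qed.

(** The threshold [4 * N + D] leaves room for avoiding the vertices already used and the at most [D]
    vertices not joined to the centre. *)
Definition popular A g P : Prop :=
  [/\ P \subset pairs A, trivIset P, 4 * N + D < #|P| & {in P, forall e, c e = g}].

(* [F] consists of cross edges, [J] of edges inside [A] or [B]; the colors in [R] are kept for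
   additional edges. *)
Definition setting A B F J R : Prop :=
  [/\ [/\ [disjoint A & B], A \subset U & B \subset U],
      [/\ F \subset pairs U, J \subset pairs U, rainbow_set (F :|: J) &
          forall e, e \in F :|: J -> c e \notin R],
      (forall v, v \in A -> #|B :\: nb F v| <= D),
      (forall v, v \in B -> #|A :\: nb F v| <= D) &
      2 * N * D + N + 2 * D + 2 < #|A| /\ 2 * N * D + N + 2 * D + 2 < #|B|].

Lemma settingC A B F J R : setting A B F J R -> setting B A F J R.
Proof. by case=> [[dAB AU BU] FJ nA nB [bA bB]]; split=> //; split=> //; rewrite disjoint_sym. Qed.

Lemma setting_rich A B F J R : setting A B F J R -> rich F N A B.
Proof.
case=> _ _ nA nB [bA bB]; split; try by (move: bA bB; clear; lia).
  by move=> x y /nA h1 /nA h2; have := card_common h1 h2; move: bB; clear; lia.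
by move=> x y /nB h1 /nB h2; have := card_common h1 h2; move: bA; clear; lia.
Qed.

Lemma card_bigcup_le (I : finType) (X : {set I}) (g : I -> {set T}) d :
  (forall i, i \in X -> #|g i| <= d) -> #|\bigcup_(i in X) g i| <= #|X| * d.
Proof.
move=> le; rewrite -sum_nat_const.
apply: (@leq_trans (\sum_(i in X) #|g i|)); last exact: leq_sum.
elim/big_rec2: _ => [|i n Y _ leY]; first by rewrite cards0.
by apply: leq_trans (cardU_le _ _) _; rewrite leq_add2l.
Qed.

Lemma setting_generic A B F J R m : setting A B F J R -> m <= N -> generic F A B m.
Proof.
case=> _ _ _ nB [bA _] mN W f WB szW f2.
have [|v vA] := @pick_notin _ A (f :|: \bigcup_(w in W) (A :\: nb F w)).
  apply: leq_ltn_trans (cardU_le _ _) _.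
  have := @card_bigcup_le _ W (fun w => A :\: nb F w) D (fun w wW => nB w (subsetP WB w wW)).
  have : #|W| * D <= 2 * N * D by rewrite leq_mul2r (leq_trans szW) ?orbT // leq_mul2l.
  by move: bA f2; clear; lia.
rewrite inE negb_or => /andP[vf /bigcupP vW]; exists v; split=> //.
apply/subsetP => w wW; rewrite in_nb; apply/negPn/negP => vw.
by apply: vW; exists w => //; rewrite !inE adjC vw.
Qed.

Lemma popular_pick A g P S : popular A g P -> #|S| <= 4 * N + D ->
  exists e, [/\ e \in P, e \in pairs A, c e = g & [disjoint e & S]].
Proof.
move=> [sP tP bP cP] szS.
have [/existsP[e /andP[eP dis]]|] := boolP [exists e, (e \in P) && [disjoint e & S]].
  by exists e; split=> //; [apply: (subsetP sP) | apply: cP].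
rewrite negb_exists => /forallP none; exfalso.
have : \sum_(e in P) 1 <= \sum_(e in P) #|e :&: S|.
  apply: leq_sum => e eP; rewrite card_gt0; have := none e.
  by rewrite eP -setI_eq0.
rewrite sum1_card; have -> : \sum_(e in P) #|e :&: S| = #|cover P :&: S|.
  rewrite -[RHS]sum1_card (eq_bigl (fun x => (x \in cover P) && (x \in S))); last first.
    by move=> x; rewrite !inE.
  rewrite (@big_trivIset_cond _ _ _ _ _ (fun x => x \in S)) //.
  by apply: eq_bigr => e _; rewrite -sum1_card; apply: eq_bigl => x; rewrite !inE.
have := subset_leq_card (subsetIr (cover P) S); move: bP szS; clear; lia.
Qed.

Lemma setting_union A B F J R X : setting A B F J R ->
  X \subset pairs U -> rainbow_set X -> (forall e, e \in X -> c e \in R) ->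
  (F :|: J) :|: X \subset pairs U /\ rainbow_set ((F :|: J) :|: X).
Proof.
case=> _ [FU JU rFJ cFJ] _ _ _ XU rX cX; split; first by rewrite !subUset FU JU XU.
exact: rainbowU rFJ rX cFJ cX.
Qed.

Lemma pairsS A B : A \subset B -> pairs A \subset pairs B.
Proof.
move=> sAB; apply/subsetP => e; rewrite !inE => /andP[sA ->].
by rewrite (subset_trans sA sAB).
Qed.

(** * Flowers from a fan and edges of reserved colors *)

Section Fan.
Variables (A B : {set T}) (F J X : {set {set T}}) (R : {set C}).
Hypothesis st : setting A B F J R.
Hypotheses (XU : X \subset pairs U) (rX : rainbow_set X).
Hypothesis cX : forall e, e \in X -> c e \in R.
Variables (v : T) (As : {set T}) (Mt : {set {set T}}).
Hypothesis fanv : fan J F A B v As Mt.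

Let E := (F :|: J) :|: X.
Let EU : E \subset pairs U. Proof. exact: (setting_union st XU rX cX).1. Qed.
Let FE : F \subset E. Proof. by rewrite /E -setUA subsetUl. Qed.
Let JE : J \subset E. Proof. by rewrite /E setUAC subsetUr. Qed.
Let XE : X \subset E. Proof. exact: subsetUr. Qed.

Let rE : rich E N A B.
Proof. exact: richS FE (setting_rich st). Qed.

Let dAB : [disjoint A & B]. Proof. by case: st => -[]. Qed.

Variable eB : {set T}.
Hypothesis JAB : forall e, e \in J -> e \subset A \/ e \subset B.

Let AsA : As \subset A.
Proof.
case: fanv => vA sAs _ _ _; apply/subsetP => a /(subsetP sAs).
rewrite in_nb => va; case: (JAB va) => /subsetP sub.
  by apply: sub; rewrite !inE eqxx orbT.
by have := disjointFr dAB vA; rewrite sub // !inE eqxx.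
Qed.

Let AsE : As \subset nb E v.
Proof. by case: fanv => _ sAs _ _ _; apply: subset_trans sAs _; apply: nbS. Qed.

Let coverB : cover Mt \subset B.
Proof.
case: fanv => _ _ sM _ _; apply/bigcupsP => e /(subsetP sM).
by case/insideW.
Qed.

Let cover_nb : cover Mt \subset nb F v.
Proof. by case: fanv => _ _ _ _ nM; apply/bigcupsP => e; apply: nM. Qed.

Lemma fan_opp e : #|As| + #|Mt| = size ls -> e \in E -> e \subset B ->
  e :&: nb F v != set0 -> [disjoint e & cover Mt] -> False.
Proof.
move=> sz eE sB meet dis; apply: (no_flower (v := v) EU (setting_union st XU rX cX).2).
have [vA _ sM tM _] := fanv.
apply: (assemble_opp (As := As) leN EU ol ls3 l5 dAB rE vA AsE AsA _ tM coverB _ sz eE sB _ dis).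
- by apply: subset_trans JE; apply: subset_trans sM _; apply/subsetP => f /insideW[].
- exact: subset_trans cover_nb (nbS v FE).
- by apply: contraNneq meet => m0; rewrite -subset0 -m0; apply: setIS; apply: nbS.
Qed.

Hypotheses (eBX : eB \in X) (eBB : eB \subset B) (eBv : eB \subset nb F v).
Hypothesis eBM : [disjoint eB & cover Mt].

Let eB0 : eB != set0.
Proof. by rewrite -card_gt0 (simple_pairs XU eBX). Qed.

Let mMt : matching E (eB |: Mt) /\ eB \notin Mt.
Proof.
case: fanv => _ _ sM tM _; apply: matchingU1 => //; last exact: (subsetP XE).
rewrite /matching tM andbT; apply: subset_trans JE.
by apply: subset_trans sM _; apply/subsetP => f /insideW[].
Qed.

Let coverU : cover (eB |: Mt) = eB :|: cover Mt.
Proof. by rewrite /cover big_setU1 //= mMt.2. Qed.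

(** The edge [eB] of a reserved color enlarges the matching of the fan, and [e] is used in the cycle
    of length [l]. *)
Lemma fan_same_extra e : (#|As| + #|Mt|).+1 = size ls -> e \in E -> e \subset A ->
  v \notin e -> [disjoint As & e] -> False.
Proof.
move=> sz eE sA ve dis; apply: (no_flower (v := v) EU (setting_union st XU rX cX).2).
have [vA _ sM tM _] := fanv; have [/andP[sM' tM'] eN] := mMt.
apply: (assemble_same (As := As) (Mt := eB |: Mt) leN EU ol ls3 l5 dAB rE vA
  AsE AsA sM' tM' _ _ _ eE sA ve dis).
- by rewrite coverU subUset eBB.
- rewrite coverU subUset (subset_trans eBv (nbS v FE)).
  exact: subset_trans cover_nb (nbS v FE).
- by rewrite cardsU1 eN addnCA add1n.
Qed.

Lemma fan_opp_extra e : (#|As| + #|Mt|).+1 = size ls -> e \in E -> e \subset B ->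
  e :&: nb F v != set0 -> [disjoint e & eB] -> [disjoint e & cover Mt] -> False.
Proof.
move=> sz eE sB meet dis1 dis2; apply: (no_flower (v := v) EU (setting_union st XU rX cX).2).
have [vA _ sM tM _] := fanv; have [/andP[sM' tM'] eN] := mMt.
apply: (assemble_opp (As := As) (Mt := eB |: Mt) leN EU ol ls3 l5 dAB rE vA AsE AsA sM' tM' _ _ _ eE sB).
- by rewrite coverU subUset eBB.
- rewrite coverU subUset (subset_trans eBv (nbS v FE)).
  exact: subset_trans cover_nb (nbS v FE).
- by rewrite cardsU1 eN addnCA add1n.
- by apply: contraNneq meet => m0; rewrite -subset0 -m0; apply: setIS; apply: nbS.
- by rewrite coverU -setI_eq0 setIUr setU_eq0 !setI_eq0 dis1.
Qed.

End Fan.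


Lemma fan_cover_card A B F J R v As Mt : setting A B F J R -> fan J F A B v As Mt ->
  #|cover Mt| = 2 * #|Mt|.
Proof.
case=> _ [_ JU _ _] _ _ _ [_ _ sM tM _].
apply: (@card_cover_matching _ J).
  exact: simple_pairs JU.
by rewrite /matching tM andbT; apply: subset_trans sM _; apply/subsetP => e /insideW[].
Qed.

(** The vertices of [B] not joined to [v] are among those avoided, so the popular edge is
    flexible. *)
Lemma pick_opp A B F J R g P v As Mt f : setting A B F J R -> popular B g P ->
  fan J F A B v As Mt -> #|Mt| <= size ls -> #|f| <= 2 ->
  exists e, [/\ e \in pairs U, c e = g, e \subset B, e \subset nb F v &
                [disjoint e & cover Mt] /\ [disjoint f & e]].
Proof.
move=> st pop fanv szM f2; have [vA _ _ _ _] := fanv.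
have [|e [eP eB ce dis]] := popular_pick (S := f :|: cover Mt :|: (B :\: nb F v)) pop.
  have := cardU_le (f :|: cover Mt) (B :\: nb F v).
  have := cardU_le f (cover Mt); rewrite (fan_cover_card st fanv).
  case: st => _ _ nA _ _; have := nA v vA; have := size_ltN.
  by move: szM f2; clear; lia.
have BU : B \subset U by case: st => -[].
move: dis; rewrite -setI_eq0 !setIUr !setU_eq0 !setI_eq0 => /andP[/andP[d1 d2] d3].
exists e; split=> //.
- by apply: (subsetP (pairsS BU)).
- by move: eB; rewrite inE => /andP[].
- move: eB; rewrite inE => /andP[/subsetP sB _]; apply/subsetP => x xe.
  by have := disjointFr d3 xe; rewrite in_setD sB // andbT => /negbFE.
- by rewrite [[disjoint f & _]]disjoint_sym.
Qed.

(** The color [gB] supplies one more flexible edge in [B], and [gA] an edge in [A] for the cycle of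
    length [l]. *)
Lemma no_flex_two A B F J R gA gB PA PB m : setting A B F J R ->
  (forall e, e \in J -> e \subset A \/ e \subset B) ->
  popular A gA PA -> popular B gB PB -> gA != gB -> gA \in R -> gB \in R ->
  m.+1 = size ls -> no_flex J F A B m.
Proof.
move=> st Jin popA popB gAB gAR gBR szl v As Mt fanv; rewrite ltnNge; apply/negP => le.
have [As' [Mt' [sA sM sz]]] := truncate_pair le.
have {}fanv := fanS fanv sA sM; have [vA _ _ _ _] := fanv.
have [||eB [eBU ceB eBB eBv [dB _]]] := pick_opp (f := set0) st popB fanv.
- by rewrite -szl -sz; clear; lia.
- by rewrite cards0.
have [|eA [eAP eAA ceA dA]] := popular_pick (S := v |: As') popA.
  have := size_ltN; rewrite -szl -sz cardsU1; case: (v \notin As'); clear; lia.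
have AU : A \subset U by case: st => -[].
have XU : [set eA; eB] \subset pairs U.
  by rewrite subUset !sub1set eBU andbT; apply: (subsetP (pairsS AU)).
have rX : rainbow_set [set eA; eB].
  move=> x y; rewrite !inE => /orP[]/eqP-> /orP[]/eqP-> //; rewrite ceA ceB => eq.
    by rewrite eq eqxx in gAB.
  by rewrite eq eqxx in gAB.
have cX e : e \in [set eA; eB] -> c e \in R.
  by rewrite !inE => /orP[]/eqP->; rewrite ?ceA ?ceB.
have eBX : eB \in [set eA; eB] by rewrite !inE eqxx orbT.
apply: (fan_same_extra st XU rX cX fanv Jin eBX eBB eBv dB (e := eA)).
- by rewrite sz szl.
- by rewrite !inE eqxx !orbT.
- by move: eAA; rewrite inE => /andP[].
- by apply/negP => /(disjointFr dA); rewrite !inE eqxx.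
- rewrite disjoint_sym; apply: disjointWr dA; exact: subsetUr.
Qed.

Section OneColor.
Variables (A B : {set T}) (F J P : {set {set T}}) (R : {set C}) (g : C).
Hypotheses (st : setting A B F J R) (popB : popular B g P) (gR : g \in R).
Hypothesis Jin : forall e, e \in J -> e \subset A \/ e \subset B.

Lemma single_extra e : e \in pairs U -> c e = g ->
  [/\ [set e] \subset pairs U, rainbow_set [set e] &
      forall f, f \in [set e] -> c f \in R].
Proof.
move=> eU ce; split; first by rewrite sub1set.
  by move=> x y; rewrite !inE => /eqP-> /eqP->.
by move=> f; rewrite inE => /eqP->; rewrite ce.
Qed.

(** The edge of color [g] itself serves the cycle of length [l]. *)
Lemma no_flex_one : no_flex J F A B (size ls).
Proof.
move=> v As Mt fanv; rewrite ltnNge; apply/negP => le.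
have [As' [Mt' [sA sM sz]]] := truncate_pair le.
have {}fanv := fanS fanv sA sM.
have [||e [eU ce eB ev [dis _]]] := pick_opp (f := set0) st popB fanv.
- by rewrite -sz; clear; lia.
- by rewrite cards0.
have [XU rX cX] := single_extra eU ce.
apply: (fan_opp st XU rX cX fanv Jin sz (e := e)) => //.
  by rewrite !inE eqxx !orbT.
by rewrite (setIidPl ev) -card_gt0 (simple_pairs (subxx _) eU).
Qed.

(** Now [f] serves the cycle of length [l] and the edge of color [g] joins the fan, of which only
    [size ls - 1] edges are used. *)
Lemma no_long_one : no_long J F A B (size ls).
Proof.
move=> v As Mt f fanv long; rewrite ltnNge; apply/negP => le.
have [|As' [Mt' [sA sM sz]]] := @truncate_pair _ As Mt (size ls).-1; first by move: le; clear; lia.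
have {}fanv := fanS fanv sA sM; have [vA _ _ _ _] := fanv.
have fJ : f \in J by case: long => [[]|[]] /insideW[].
have JU : J \subset pairs U by case: st => _ [].
have [||e [eU ce eB ev [dis disf]]] := pick_opp (f := f) st popB fanv.
- by move: sz ls_gt0; clear; lia.
- by rewrite (simple_pairs JU fJ).
have [XU rX cX] := single_extra eU ce.
have sz' : (#|As'| + #|Mt'|).+1 = size ls by move: sz ls_gt0; clear; lia.
have fE : f \in (F :|: J) :|: [set e] by rewrite !inE fJ orbT.
case: long => [[fA [vf dAs]]|[fB meet dMt]].
  apply: (fan_same_extra st XU rX cX fanv Jin (set11 e) eB ev dis sz' fE _ vf).
    by case/insideW: fA.
  exact: disjointWl dAs.
apply: (fan_opp_extra st XU rX cX fanv Jin (set11 e) eB ev dis sz' fE _ meet disf).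
  by case/insideW: fB.
apply: disjointWr dMt; apply/subsetP => x /bigcupP[h hM xh].
exact: in_cover (subsetP sM h hM) xh.
Qed.

End OneColor.

Definition reserve G R : {set {set T}} := [set e in G | c e \notin R].

(** As [G] is rainbow, each color of [R] removes at most one edge at [v]. *)
Lemma reserve_miss G (X : {set T}) v D0 R : G \subset pairs U -> rainbow_set G ->
  #|X :\: nb G v| <= D0 -> #|X :\: nb (reserve G R) v| <= D0 + #|R|.
Proof.
move=> GU rG le; pose Y := [set b in nb G v | c [set v; b] \in R].
have sub : X :\: nb (reserve G R) v \subset (X :\: nb G v) :|: Y.
  apply/subsetP => b; rewrite !inE /adj !inE negb_and negbK.
  by case/andP=> /orP[->|cR] ->; rewrite ?andbT //= cR; case: (_ \in G).
apply: leq_trans (subset_leq_card sub) _; apply: leq_trans (cardU_le _ _) _.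
apply: leq_add => //; rewrite -(card_in_imset (f := fun b => c [set v; b])).
  by apply: subset_leq_card; apply/subsetP => g /imsetP[b]; rewrite inE => /andP[_ ?] ->.
move=> b b'; rewrite !inE => /andP[vb _] /andP[vb' _] eq.
have /setP/(_ b) := rG _ _ vb vb' eq; rewrite !inE eqxx orbT => /esym/orP[]/eqP // bv.
by have [_ _] := adj_pairs GU vb; rewrite bv eqxx.
Qed.

Lemma reserve_sub G R : reserve G R \subset G.
Proof. by apply/subsetP => e; rewrite inE => /andP[]. Qed.

(** * Existence of popular colors and the count of all colors *)

Section Base.
Variables (A B : {set T}) (G : {set {set T}}) (D0 : nat).
Hypotheses (dAB : [disjoint A & B]) (AU : A \subset U) (BU : B \subset U).
Hypotheses (GU : G \subset pairs U) (rG : rainbow_set G) (DE : D = D0 + N).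
Hypothesis nearA : forall v, v \in A -> #|B :\: nb G v| <= D0.
Hypothesis nearB : forall v, v \in B -> #|A :\: nb G v| <= D0.
Let Q := N * (4 * N + D + 1).
Hypotheses (bigA : 2 * Q + 2 * N * D + N + 2 * D + 2 < #|A|).
Hypotheses (bigB : 2 * Q + 2 * N * D + N + 2 * D + 2 < #|B|).

Lemma setting_reserve J R R' : #|R| <= N -> J \subset pairs U ->
  rainbow_set (reserve G R :|: J) ->
  (forall e, e \in reserve G R :|: J -> c e \notin R') ->
  setting A B (reserve G R) J R'.
Proof.
move=> RN JU rGJ cGJ; split=> //.
- by split=> //; apply: subset_trans (reserve_sub _ _) GU.
- move=> v vA; apply: leq_trans (reserve_miss R GU rG (nearA vA)) _.
  by rewrite DE leq_add2l.
- move=> v vB; apply: leq_trans (reserve_miss R GU rG (nearB vB)) _.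
  by rewrite DE leq_add2l.
- by move: bigA bigB; clear; lia.
Qed.

(* With a generic centre in [B], every edge of [M] can be used in a cycle of any odd length. *)
Lemma no_rainbow_matching M : M \subset pairs A -> trivIset M -> rainbow_set M ->
  #|M| = (size ls).+1 -> False.
Proof.
move=> MA tM rM szM; pose R := c @: M.
have RN : #|R| <= N.
  by apply: leq_trans (leq_imset_card _ _) _; rewrite szM; apply: size_ltN.
have MU := subset_trans MA (pairsS AU).
have st : setting A B (reserve G R) M set0.
  apply: setting_reserve RN MU _ _; last by move=> e _; rewrite inE.
  apply: (rainbowU (R := R) (rainbowS (reserve_sub _ _) rG) rM) => e.
    by rewrite inE => /andP[].
  exact: imset_f.
have st' := settingC st.
have [e eM] : exists e, e \in M by apply/set0Pn; rewrite -card_gt0 szM.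
have subA f : f \in M -> f \subset A by move=> /(subsetP MA); rewrite inE => /andP[].
have coverA : cover M \subset A by apply/bigcupsP => f /subA.
have szC : #|cover M| = 2 * #|M|.
  apply: (@card_cover_matching _ M); first exact: simple_pairs MU.
  by rewrite /matching subxx.
have [||v [vB _ sub]] := setting_generic st' size_ltN (f := set0) coverA.
- by rewrite szC szM.
- by rewrite cards0.
have fanv : fan M (reserve G R) B A v set0 (M :\ e).
  split; rewrite ?sub0set //.
  - by apply/subsetP => f /setD1P[_ fM]; rewrite inE fM subA.
  - exact: trivIsetD.
  - by move=> f /setD1P[_ fM]; apply: subset_trans sub; apply: bigcup_sup.
have X0 : [set f : {set T} | false] \subset pairs U by apply/subsetP => f; rewrite inE.
apply: (fan_opp (X := [set f | false]) st' X0 _ _ fanv _ _ (e := e)).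
- by move=> x y; rewrite inE.
- by move=> x; rewrite inE.
- by move=> f /subA; right.
- by rewrite cards0 add0n; move: szM; rewrite (cardsD1 e) eM add1n => -[].
- by rewrite !inE eM orbT.
- exact: subA.
- have : e \subset nb (reserve G R) v by apply: subset_trans sub; apply: bigcup_sup.
  by move/setIidPl->; rewrite -card_gt0 (simple_pairs MU eM).
- by rewrite (coverD1 tM eM) -setI_eq0 setIDA setDIl setDv set0I.
Qed.

(** All pairs in [A] are available, so there is a matching of [Q] edges. By [no_rainbow_matching] it
    has fewer than [N] colors, and one of them occurs more than [4 * N + D] times. *)
Lemma popular_ex : exists g P, popular A g P.
Proof.
have [[M [/andP[sM tM] szM _]]|[W [WA le ind]]] :=
  matching_or_indep A Q (simple_pairs (subxx (pairs A))); last first.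
  exfalso; have W1 : #|W| <= 1.
    apply/card_le1_eqP => x y xW yW; apply/eqP/negPn/negP => xy.
    case/negP: (ind x y xW yW); apply/pairsP; exists x, y.
    by split; rewrite 1?eq_sym //; apply: (subsetP WA).
  by move: le W1 bigA; clear; lia.
have [|Mr [_ sMr rMr cMr]] := @rainbow_extend set0 M (sub0set M).
  by move=> e f; rewrite inE.
have [big|small] := leqP (size ls).+1 #|Mr|.
  have [Mk sMk szMk] := subset_of_card big.
  exfalso; apply: (no_rainbow_matching (M := Mk)) => //.
  - exact: subset_trans sMk (subset_trans sMr sM).
  - exact: trivIsetS (subset_trans sMk sMr) tM.
  - exact: rainbowS sMk rMr.
have [/existsP[g big]|] := boolP [exists g, 4 * N + D < #|[set e in M | c e == g]|].
  exists g, [set e in M | c e == g]; split=> //.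
  - by apply: subset_trans sM; apply/subsetP => e; rewrite inE => /andP[].
  - by apply: trivIsetS tM; apply/subsetP => e; rewrite inE => /andP[].
  - by move=> e; rewrite inE => /andP[_ /eqP].
rewrite negb_exists => /forallP none; exfalso.
have : #|M| <= #|c @: M| * (4 * N + D).
  rewrite -[X in X <= _]sum1_card (partition_big_imset c) -sum_nat_const /=.
  apply: leq_sum => g _; have := none g; rewrite -leqNgt; apply: leq_trans.
  by rewrite sum1dep_card subset_leq_card //; apply/subsetP => e; rewrite !inE.
rewrite szM -cMr; have : #|c @: Mr| < N.
  exact: leq_ltn_trans (leq_imset_card _ _) (leq_trans small size_ltN).
rewrite /Q; move: #|_| => r; clear; nia.
Qed.

End Base.


Lemma reserve_card G R : rainbow_set G -> #|G| <= #|reserve G R| + #|(c @: G) :&: R|.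
Proof.
move=> rG; have -> : #|(c @: G) :&: R| = #|G :\: reserve G R|.
  have rD : rainbow_set (G :\: reserve G R) by apply: rainbowS rG; apply: subsetDl.
  rewrite -(card_in_imset rD); apply: eq_card => g; rewrite inE.
  apply/andP/imsetP => [[/imsetP[e eG ->] gR]|[e]].
    by exists e; rewrite // !inE eG gR.
  rewrite !inE => /andP[] /[swap] eG; rewrite eG /= negbK => eR ->.
  by rewrite imset_f.
by rewrite -(cardsID (reserve G R) G) leq_add2r subset_leq_card ?subsetIr.
Qed.

Lemma cross_card F A B :
  (forall e, e \in F -> exists x y, [/\ x \in A, y \in B & e = [set x; y]]) ->
  #|F| + #|mis F A B| <= #|A| * #|B|.
Proof.
move=> Fcr; pose N1 := [set p in setX A B | adj F p.1 p.2].
have -> : #|A| * #|B| = #|N1| + #|mis F A B|.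
  rewrite -cardsX -(cardsID [set p | adj F p.1 p.2] (setX A B)).
  by congr (_ + _); apply: eq_card => p; rewrite !inE // andbC.
rewrite leq_add2r; apply: leq_trans (leq_imset_card (fun p => [set p.1; p.2]) N1).
apply: subset_leq_card; apply/subsetP => e eF; have [x [y [xA yB eE]]] := Fcr e eF.
by apply/imsetP; exists (x, y); rewrite // !inE xA yB /adj /= -eE.
Qed.

(** If the popular colors of the two sides differ, two colors are reserved, and the bound of
    [turan_flex] is strict; if they agree, one is reserved and [turan_long] applies. Both cases give
    the same total, as the missing pairs cancel against [cross_card]. *)
Lemma too_many_colors A B G0 D0 :
  A :|: B = U -> [disjoint A & B] -> G0 \subset pairs U -> rainbow_set G0 ->
  (forall v, v \in A -> #|B :\: nb G0 v| <= D0) ->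
  (forall v, v \in B -> #|A :\: nb G0 v| <= D0) ->
  D = D0 + N ->
  2 * (N * (4 * N + D + 1)) + 2 * N * D + N + 2 * D + 2 < #|A| ->
  2 * (N * (4 * N + D + 1)) + 2 * N * D + N + 2 * D + 2 < #|B| ->
  #|c @: pairs U| <= #|A| * #|B| + (size ls).-1 ^ 2 + 1.
Proof.
move=> AB dAB G0U rG0 near0A near0B DE bigA bigB; rewrite leqNgt; apply/negP => many.
have AU : A \subset U by rewrite -AB subsetUl.
have BU : B \subset U by rewrite -AB subsetUr.
pose Cr := [set e in pairs U | ~~ (e \subset A) && ~~ (e \subset B)].
have Cross e : e \in Cr -> exists x y, [/\ x \in A, y \in B & e = [set x; y]].
  rewrite inE => /andP[/pairsP[x [y [xU yU xy eE]]] /andP[eA eB]].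
  have inn z : z \in U -> (z \in A) || (z \in B) by rewrite -AB inE.
  have subs (X : {set T}) : (x \in X) -> (y \in X) -> e \subset X.
    by move=> xX yX; rewrite eE subUset !sub1set xX.
  case/orP: (inn x xU) => hx; case/orP: (inn y yU) => hy.
  - by rewrite (subs A) in eA.
  - by exists x, y.
  - by exists y, x; rewrite setUC.
  - by rewrite (subs B) in eB.
have AdjCr x y : x \in A -> y \in B -> [set x; y] \in Cr.
  move=> xA yB; rewrite inE !subUset !sub1set.
  rewrite (disjointFr dAB xA) (disjointFl dAB yB) andbF /= andbT.
  apply/pairsP; exists x, y; rewrite (subsetP AU) // (subsetP BU) //; split=> //.
  by apply: contraTneq yB => <-; rewrite (disjointFr dAB xA).
have CrU : Cr \subset pairs U by apply/subsetP => e; rewrite inE => /andP[].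
(* Cross edges of [G0] are kept as representatives, so that [G] is still nearly complete between [A]
   and [B]. *)
have [|G [sG GCr rG cG]] := @rainbow_extend (G0 :&: Cr) Cr (subsetIr _ _).
  exact: rainbowS (subsetIl _ _) rG0.
(* The edges whose color occurs on no cross edge; they lie within one side. *)
pose In := [set e in pairs U | c e \notin c @: Cr].
have [|J [_ JIn rJ cJ]] := @rainbow_extend set0 In (sub0set _).
  by move=> e f; rewrite inE.
have GU := subset_trans GCr CrU.
have JU : J \subset pairs U.
  by apply: subset_trans JIn _; apply/subsetP => e; rewrite inE => /andP[].
have Jc e : e \in J -> c e \notin c @: Cr by move/(subsetP JIn); rewrite inE => /andP[].
have Gc e : e \in G -> c e \in c @: Cr by move/(subsetP GCr) => ?; apply: imset_f.
have Jin e : e \in J -> e \subset A \/ e \subset B.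
  move=> eJ; case eA: (e \subset A); first by left.
  case eB: (e \subset B); first by right.
  by have /imsetP[] := Jc e eJ; exists e; rewrite // inE eA eB (subsetP JU).
have nearA v : v \in A -> #|B :\: nb G v| <= D0.
  move=> vA; apply: leq_trans (near0A v vA); apply: subset_leq_card.
  apply/subsetP => b; rewrite !in_setD !in_nb => /andP[vb bB]; rewrite bB andbT.
  by apply: contra vb => vb; apply: (subsetP sG); rewrite inE -[_ \in G0]/(adj G0 v b) vb AdjCr.
have nearB v : v \in B -> #|A :\: nb G v| <= D0.
  move=> vB; apply: leq_trans (near0B v vB); apply: subset_leq_card.
  apply/subsetP => b; rewrite !in_setD !in_nb => /andP[vb bB]; rewrite bB andbT.
  rewrite !(adjC _ v b) in vb *; apply: contra vb => vb; apply: (subsetP sG).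
  by rewrite inE AdjCr // andbT.
have dBA : [disjoint B & A] by rewrite disjoint_sym.
have [gA [PA popA]] := popular_ex dAB AU BU GU rG DE nearA nearB bigA bigB.
have [gB [PB popB]] := popular_ex dBA BU AU GU rG DE nearB nearA bigB bigA.
have rGJ : rainbow_set (J :|: G) by apply: rainbowU rJ rG Jc Gc.
pose R := [set gA; gB]; have R2 : #|R| <= 2 by rewrite cards2; case: (_ != _).
have N2 : 2 <= N by apply: leq_trans size_ltN; rewrite ltnS.
have st : setting A B (reserve G R) (reserve J R) R.
  apply: (setting_reserve dAB AU BU GU rG DE nearA nearB bigA bigB (leq_trans R2 N2)).
  - exact: subset_trans (reserve_sub _ _) JU.
  - apply: rainbowS rGJ; rewrite setUC; apply: setUSS; exact: reserve_sub.
  - by move=> e; rewrite !inE => /orP[] /andP[].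
have st' := settingC st.
have J2 : simple (reserve J R) by apply: (@simple_pairs _ _ U); case: st => _ [].
have Jin' e : e \in reserve J R -> e \subset A \/ e \subset B.
  by move/(subsetP (reserve_sub _ _))/Jin.
have Jin'' e : e \in reserve J R -> e \subset B \/ e \subset A by move/Jin'; tauto.
have count : #|c @: pairs U| <= #|reserve G R| + #|reserve J R| + #|R|.
  have : c @: pairs U \subset c @: G :|: c @: J.
    apply/subsetP => g /imsetP[e eU ->]; rewrite inE cG cJ.
    have [//|no] := boolP (c e \in c @: Cr).
    by apply/imsetP; exists e; rewrite // inE eU.
  move/subset_leq_card/leq_trans; apply; apply: leq_trans (cardU_le _ _) _.
  rewrite !card_in_imset //.
  have hG := reserve_card R rG; have hJ := reserve_card R rJ.
  apply: leq_trans (leq_add hG hJ) _; rewrite addnACA leq_add2l.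
  rewrite -cardsUI -setIUl setIACA.
  have -> : c @: G :&: c @: J = set0.
    apply/setP => g; rewrite !inE; apply/negP => /andP[/imsetP[e /Gc eG ->] /imsetP[f /Jc fJ eq]].
    by rewrite -eq eG in fJ.
  by rewrite set0I cards0 addn0 subset_leq_card ?subsetIr.
have cross : #|reserve G R| + #|mis (reserve G R) A B| <= #|A| * #|B|.
  by apply: cross_card => e /(subsetP (reserve_sub _ _))/(subsetP GCr); apply: Cross.
have gAR : gA \in R by rewrite !inE eqxx.
have gBR : gB \in R by rewrite !inE eqxx orbT.
have szN : size ls <= N by apply: ltnW; apply: size_ltN.
have [eqg|neqg] := eqVneq gA gB.
  have R1 : #|R| = 1 by rewrite /R eqg setUid cards1.
  have := turan_long J2 dAB Jin' (setting_generic st szN) (setting_generic st' szN)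
    (no_flex_one st popB gBR Jin') (no_flex_one st' popA gAR Jin'')
    (no_long_one st popB gBR Jin') (no_long_one st' popA gAR Jin'').
  by move: many count cross; rewrite R1; clear; lia.
have szN' : (size ls).-1 <= N by apply: leq_trans szN; apply: leq_pred.
have szE : (size ls).-1.+1 = size ls by rewrite prednK.
have neqg' : gB != gA by rewrite eq_sym.
have := turan_flex J2 Jin' (setting_generic st szN') (setting_generic st' szN')
  (no_flex_two st Jin' popA popB neqg gAR gBR szE)
  (no_flex_two st' Jin'' popB popA neqg' gBR gAR szE).
by move: many count cross R2; clear; lia.
Qed.

End Final.
End Coloring.

(** * The number of colors without a rainbow flower *)

(** The difference of the two quarter squares is half of [u], rounded down. *)
Lemma quarter_square_step u : u <= 2 * (u ^ 2 %/ 4 - u.-1 ^ 2 %/ 4) + 1.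
Proof.
case: u => // u /=; have uE := odd_double_half u; set h := u./2 in uE.
have E1 : u ^ 2 = (h * h + odd u * h) * 4 + odd u.
  by rewrite -[in LHS]uE; case: (odd u); rewrite -mul2n; nia.
have E2 : u.+1 ^ 2 = (h * h + h + odd u * h.+1) * 4 + ~~ odd u.
  by rewrite -[in LHS]uE; case: (odd u); rewrite -mul2n; nia.
rewrite E1 E2 !divnMDl // !divn_small ?addn0; try by case: (odd u).
by rewrite -[u in X in X <= _]uE; case: (odd u); rewrite -mul2n; lia.
Qed.

Lemma surplus_step (a b cU cV u K n d : nat) :
  a + K + n <= cU + u.+1 -> cV + u < b + K + n -> cU <= cV + d -> a - b <= d.
Proof. lia. Qed.

Section Upper.
Variables (T C : finType) (c : {set T} -> C).
Implicit Types (E G : {set {set T}}) (U : {set T}).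

Lemma colors_bound U : #|c @: pairs U| <= #|U| * #|U|.
Proof.
apply: leq_trans (leq_imset_card _ _) _; rewrite -cardsX.
apply: leq_trans (leq_imset_card (fun p => [set p.1; p.2]) _).
apply: subset_leq_card; apply/subsetP => e /pairsP[x [y [xU yU _ ->]]].
by apply/imsetP; exists (x, y); rewrite // !inE xU.
Qed.

(* The colors lost with [v] are represented in [G] by edges at [v]. *)
Lemma representing_deg U G v : G \subset pairs U -> c @: G = c @: pairs U ->
  #|c @: pairs U| <= #|c @: pairs (U :\ v)| + #|nb G v|.
Proof.
move=> GU cG; rewrite deg_edges; last exact: simple_pairs GU.
have sub : c @: pairs U \subset c @: pairs (U :\ v) :|: c @: [set e in G | v \in e].
  rewrite -cG; apply/subsetP => g /imsetP[e eG ->]; rewrite inE.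
  have [ve|ve] := boolP (v \in e).
    by rewrite orbC imset_f // inE eG.
  rewrite imset_f //; have /pairsP[x [y [xU yU xy eE]]] := subsetP GU e eG.
  apply/pairsP; exists x, y; split=> //; rewrite !inE ?xU ?yU andbT;
    by apply: contraNneq ve => <-; rewrite eE !inE eqxx ?orbT.
apply: leq_trans (subset_leq_card sub) _; apply: leq_trans (cardU_le _ _) _.
by rewrite leq_add2l leq_imset_card.
Qed.

Variables (l : nat) (ls : seq nat).
Hypotheses (ol : all odd (l :: ls)) (ls3 : all (leq 3) ls) (l5 : 5 <= l).
Hypothesis ls_gt0 : 0 < size ls.
Hypothesis no_flower : forall E v,
  E \subset pairs setT -> rainbow_set c E -> ~ flower E v (l :: ls).

Let N := (sumn (l :: ls)).+1.
(** The strongest size requirement is quadratic in [N], from [N * (4 * N + D + 1)] with [D] linear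
    in [N]; the factor 1000 is generous. *)
Definition size_threshold M := 1000 * (M.+1 * M.+1).
Let m0 := size_threshold N.

Lemma colors_le : m0 * m0 + m0 < #|T| ->
  #|c @: pairs setT| <= #|T| ^ 2 %/ 4 + (size ls).-1 ^ 2 + 1.
Proof.
move=> Tbig; rewrite leqNgt; apply/negP => many.
set K := (size ls).-1 ^ 2 + 2.
(* The required excess over the quarter square grows by one with each removed vertex. Hence a set
   with surplus cannot be small, having too few pairs for so many colors. *)
pose surplus U := #|U| ^ 2 %/ 4 + K + #|T| <= #|c @: pairs U| + #|U|.
have sT : surplus setT by rewrite /surplus cardsT leq_add2r /K; move: many; lia.
case: (arg_minnP (fun U : {set T} => #|U|) sT) => U sU minU.
have szU : #|U| <= #|T| by apply: max_card.
have Ubig : m0 < #|U|.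
  rewrite ltnNge; apply/negP => Usmall.
  have h1 := colors_bound U; have h2 : #|U| * #|U| <= m0 * m0 by apply: leq_mul.
  by move: sU; rewrite /surplus; move: Tbig Usmall h1 h2; clear; lia.
have [|G [_ GU rG cG]] := @rainbow_extend _ _ c set0 (pairs U) (sub0set _).
  by move=> e f; rewrite inE.
have deg v : v \in U -> #|U| <= 2 * #|nb G v| + 1.
  move=> vU; have h := representing_deg v GU cG.
  have szD : #|U| = #|U :\ v|.+1 by rewrite (cardsD1 v) vU.
  have : ~~ surplus (U :\ v) by apply/negP => /minU; rewrite szD ltnn.
  rewrite /surplus -ltnNge => small; rewrite /surplus in sU.
  apply: leq_trans (quarter_square_step #|U|) _; rewrite leq_add2r leq_mul2l /=.
  rewrite szD /= in sU *; exact: surplus_step sU small h.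
have UT : pairs U \subset pairs setT by apply: pairsS; apply: subsetT.
have no_flowerU E v : E \subset pairs U -> rainbow_set c E -> ~ flower E v (l :: ls).
  by move=> EU; apply: no_flower; apply: subset_trans EU UT.
have [||A [B [AB dAB nearA nearB [bigA bigB]]]] :=
    near_bipartite (leqnn N) GU ol ls3 l5 _ deg.
- by move=> v; apply: no_flowerU.
- by move: Ubig; rewrite /m0 /size_threshold; clear; nia.
have bound X : m0 < #|U| -> #|U| <= 2 * X + 24 * N + 21 ->
    2 * (N * (4 * N + (24 * N + 21 + N) + 1)) + 2 * N * (24 * N + 21 + N) + N +
    2 * (24 * N + 21 + N) + 2 < X.
  by rewrite /m0 /size_threshold; move: #|U| => u; clear; nia.
have := too_many_colors (D := 24 * N + 21 + N) (leqnn N) ol ls3 l5 ls_gt0 no_flowerU AB dAB GU rG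
  nearA nearB erefl (bound _ Ubig bigA) (bound _ Ubig bigB).
have szAB : #|A| + #|B| = #|U| by rewrite -AB cardsU disjoint_setI0 // cards0 subn0.
have : #|A| * #|B| <= #|U| ^ 2 %/ 4.
  by rewrite leq_divRL // mulnC -szAB; apply: nat_AGM2.
move: sU szU; rewrite /surplus /K; clear; lia.
Qed.

End Upper.

(** * Flowers and copies of the graph *)

Lemma flatten_nth_inj (X : eqType) (ds : seq (seq X)) z i j :
  uniq (flatten ds) -> z \in nth [::] ds i -> z \in nth [::] ds j -> i = j.
Proof.
have inf (es : seq (seq X)) k : z \in nth [::] es k -> z \in flatten es.
  move=> zk; have ks : k < size es by rewrite ltnNge; apply: contraL zk => ?; rewrite nth_default.
  by apply/flattenP; exists (nth [::] es k); rewrite ?mem_nth.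
elim: ds i j => [|d ds IH] i j; first by rewrite !nth_nil.
rewrite /= cat_uniq => /and3P[_ /hasPn dis us].
case: i j => [|i] [|j] //=.
- by move=> zd /inf/dis; rewrite zd.
- by move=> /inf/dis zd zd'; rewrite zd' in zd.
- by move=> zi zj; rewrite (IH i j us zi zj).
Qed.

Lemma uniq_flatten_mem (X : eqType) (ds : seq (seq X)) d :
  uniq (flatten ds) -> d \in ds -> uniq d.
Proof.
elim: ds => // d' ds IH; rewrite /flatten /= -/(flatten ds) cat_uniq inE.
by case/and3P=> ud _ /IH h /orP[/eqP->|/h].
Qed.

(** Otherwise [g] alternates along the cycle, whose length would be even. *)
Lemma odd_cycle_monochromatic (X : finType) (g : X -> bool) (s : seq X) :
  uniq s -> odd (size s) -> exists2 x, x \in s & g (next s x) = g x.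
Proof.
move=> us os; have [/existsP[x /andP[xs /eqP gx]]|] :=
  boolP [exists x, (x \in s) && (g (next s x) == g x)]; first by exists x.
rewrite negb_exists => /forallP none.
have cyc : cycle (fun x y => g y != g x) s.
  by apply: cycle_from_next us _ => x xs; have := none x; rewrite xs.
have alt x p : path (fun x y => g y != g x) x p -> g (last x p) = g x (+) odd (size p).
  elim: p x => [|y p IH] x /=; first by rewrite addbF.
  move=> /andP[yx /IH ->]; move: yx; case: (g y); case: (g x); case: (odd _) => //.
case: s us os cyc {none} => // x p us os /= /alt; rewrite last_rcons size_rcons.
by rewrite /= in os *; rewrite os; case: (g x).
Qed.

Section Hst.
Variables (s t : nat) (H : sgraph) (v : H) (C : 'I_s + 'I_t -> seq H).
Notation I := ('I_s + 'I_t)%type.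
Hypothesis Cv : forall k, uniq (C k) /\ v \in C k.
Hypothesis C3 : forall i, size (C (inl i)) = 3.
Hypothesis C5 : forall j, odd (size (C (inr j))) /\ 5 <= size (C (inr j)).
Hypothesis Cdis : forall k l x, k != l -> x \in C k -> x \in C l -> x = v.
Hypothesis Ccov : forall x, exists k, x \in C k.
Hypothesis HE : edges H = \bigcup_k cycle_edges (C k).
Variable k0 : I.

(** The cycle is determined except for the centre [v], which lies on all of them and gets an
    arbitrary one. *)
Definition petal (x : H) : I := odflt k0 [pick k | x \in C k].

Lemma petal_in x : x \in C (petal x).
Proof.
rewrite /petal; case: pickP => [//|none]; have [k xk] := Ccov x.
by have := none k; rewrite xk.
Qed.

Lemma petalE x k : x != v -> x \in C k -> petal x = k.
Proof.
move=> xv xk; apply/eqP/negPn/negP => neq; case/negP: xv; apply/eqP.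
exact: Cdis neq (petal_in x) xk.
Qed.

Lemma odd_petal k : odd (size (C k)).
Proof. by case: k => i; [rewrite C3 | case: (C5 i)]. Qed.

Definition spoke k : seq H := behead (rot (index v (C k)) (C k)).

Lemma spokeE k : rot (index v (C k)) (C k) = v :: spoke k.
Proof. by rewrite /spoke rot_index //; case: (Cv k). Qed.

Lemma spoke_uniq k : uniq (v :: spoke k).
Proof. by rewrite -spokeE rot_uniq; case: (Cv k). Qed.

Lemma spoke_mem k x : (x \in v :: spoke k) = (x \in C k).
Proof. by rewrite -spokeE mem_rot. Qed.

Lemma spoke_size k : (size (spoke k)).+1 = size (C k).
Proof. by rewrite -[RHS](size_rot (index v (C k))) spokeE. Qed.

Lemma spoke_next k x : next (C k) x = next (v :: spoke k) x.
Proof. by rewrite -spokeE next_rot //; case: (Cv k). Qed.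

(** The vertices of [spoke k] go in order to those of the corresponding cycle of the flower. The
    list [ks] fixes this correspondence; disjointness of the cycles away from the centre makes the
    map injective. *)
Lemma flower_copy n (X : finType) (c : {set K n} -> X) (E : {set {set K n}})
    (w : K n) (ks : seq I) :
  uniq ks -> (forall k, k \in ks) -> E \subset pairs setT -> rainbow_set c E ->
  flower E w [seq size (C k) | k <- ks] -> has_rainbow_copy H c.
Proof.
move=> uks allks EU rE [ds [szds /allP pds /andP[wds uds]]].
pose D k := nth [::] ds (index k ks).
have szks : size ds = size ks by move/(congr1 size): szds; rewrite !size_map.
have Dds k : D k \in ds by rewrite mem_nth // szks index_mem.
have Dsz k : size (D k) = size (spoke k).
  apply: succn_inj; rewrite spoke_size.
  have ik : index k ks < size ks by rewrite index_mem.
  have := congr1 (fun r => nth 0 r (index k ks)) szds.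
  by rewrite (nth_map [::]) ?szks // (nth_map k) // nth_index.
have Dflat k z : z \in D k -> z \in flatten ds by move=> zk; apply/flattenP; exists (D k).
have Dinj k k' z : z \in D k -> z \in D k' -> k = k'.
  move=> zk zk'; have := flatten_nth_inj uds zk zk'.
  by move/(congr1 (nth k ks)); rewrite !nth_index.
have Dw k : uniq (w :: D k).
  rewrite /=; apply/andP; split; first by apply: contra wds; apply: Dflat.
  exact: uniq_flatten_mem uds (Dds k).
pose f0 x := if x == v then w else nth w (D (petal x)) (index x (spoke (petal x))).
pose f : {ffun H -> K n} := finfun f0.
have in_spoke x : x != v -> x \in spoke (petal x).
  by move=> xv; have := petal_in x; rewrite -spoke_mem inE (negPf xv).
have f_in x : x != v -> f x \in D (petal x).
  move=> xv; rewrite ffunE /f0 (negPf xv) mem_nth // Dsz index_mem.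
  exact: in_spoke.
have fv : f v = w by rewrite ffunE /f0 eqxx.
have f_inj : injective f.
  move=> x y eq; have [xv|xv] := eqVneq x v; have [yv|yv] := eqVneq y v.
  - by rewrite xv yv.
  - by have := Dflat _ _ (f_in y yv); rewrite -eq xv fv (negPf wds).
  - by have := Dflat _ _ (f_in x xv); rewrite eq yv fv (negPf wds).
  have pxy : petal x = petal y.
    by apply: (Dinj _ _ (f x)); [apply: f_in | rewrite eq; apply: f_in].
  move: eq; rewrite !ffunE /f0 (negPf xv) (negPf yv) -pxy => /eqP.
  have yin : y \in spoke (petal x) by rewrite pxy in_spoke.
  rewrite nth_uniq ?Dsz ?index_mem ?in_spoke //; last by case/andP: (Dw (petal x)).
  by move=> /eqP/(congr1 (nth v (spoke (petal x)))); rewrite !nth_index ?in_spoke.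
have f_map k : map f (v :: spoke k) = w :: D k.
  rewrite /= fv; congr (_ :: _); apply: (@eq_from_nth _ w); rewrite size_map ?Dsz // => i ik.
  rewrite (nth_map v) //; set x := nth v _ i.
  have xk : x \in spoke k by apply: mem_nth.
  have /andP[vk usk] := spoke_uniq k.
  have xv : x != v by apply: contraNneq vk => <-.
  have -> : f x = nth w (D k) (index x (spoke k)).
    by rewrite ffunE /f0 (negPf xv) (@petalE x k) // -spoke_mem inE xk orbT.
  by rewrite /x index_uniq.
have copyE : copy_edges f \subset E.
  apply/subsetP => _ /imsetP[e + ->]; rewrite HE => /bigcupP[k _ /imsetP[x xk ->]].
  rewrite imsetU !imset_set1 spoke_next -(next_map f_inj (spoke_uniq k)) f_map.
  apply: (@next_cycle _ (adj E)); first exact: pds.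
  by rewrite -f_map map_f // spoke_mem.
apply/existsP; exists f; rewrite /is_copy; apply/andP; split; [apply/andP; split|].
- exact/injectiveP.
- apply: subset_trans copyE _; apply/subsetP => e /(subsetP EU).
  by rewrite !inE => /andP[].
apply/forallP => e; apply/implyP => eE; apply/forallP => e'; apply/implyP => e'E.
by apply/implyP => /eqP eq; apply/eqP/rE; rewrite ?(subsetP copyE).
Qed.

(* At most one cycle of a rainbow copy uses the color [None]; every other cycle, being odd, has an
   edge between [X] and [Y]. The centre misses [X] or [Y], and that set is then too small. *)
Lemma no_rainbow_copy n (X Y : {set K n}) (par : K n -> bool) (E : {set {set K n}})
    (col : {set K n} -> option {set K n}) :
  [disjoint X & Y] -> #|X| < (s + t).-1 -> #|Y| < (s + t).-1 ->
  (forall e x y, e \in E -> e = [set x; y] -> par x = par y ->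
     (x \in X /\ y \in Y) \/ (x \in Y /\ y \in X)) ->
  (forall e, e \notin E -> col e = None) ->
  ~~ has_rainbow_copy H col.
Proof.
move=> dXY szX szY EXY colN; apply/negP => /existsP[f /andP[/andP[/injectiveP f_inj _] /forallP rb]].
pose bad := [set k | [exists x in C k, f @: [set x; next (C k) x] \notin E]].
have badP k : k \notin bad -> forall x, x \in C k -> f @: [set x; next (C k) x] \in E.
  rewrite inE negb_exists => /forallP h x xk.
  by have := h x; rewrite xk /= negbK.
have edgeC k x : x \in C k -> [set x; next (C k) x] \in edges H.
  by move=> xk; rewrite HE; apply/bigcupP; exists k => //; apply/imsetP; exists x.
(* Two edges of color [None] in a rainbow copy coincide, and an edge lying on two cycles would have
   [v] as its only vertex. *)
have bad1 : #|bad| <= 1.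
  apply/card_le1_eqP => k k'; rewrite !inE => /existsP[x /andP[xk xE]] /existsP[x' /andP[xk' xE']].
  have e1 := edgeC k x xk; have e2 := edgeC k' x' xk'.
  have := rb (f @: [set x; next (C k) x]); rewrite (imset_f (fun e : {set H} => f @: e) e1) /=.
  move=> /forallP/(_ (f @: [set x'; next (C k') x'])).
  rewrite (imset_f (fun e : {set H} => f @: e) e2) /= !colN // eqxx /= => /eqP/(imset_inj f_inj) eq.
  apply/eqP/negPn/negP => neq.
  have allv z : z \in [set x; next (C k) x] -> z = v.
    move=> zk; have zk' := zk; rewrite eq in zk'.
    apply: (Cdis (k := k) (l := k')); first by rewrite eq_sym.
      by move: zk; rewrite !inE => /orP[]/eqP->; rewrite ?mem_next.
    by move: zk'; rewrite !inE => /orP[]/eqP->; rewrite ?mem_next.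
  have := edgesP e1; have -> : [set x; next (C k) x] = [set v].
    apply/setP => z; rewrite [RHS]inE; apply/idP/eqP => [/allv //|->].
    by rewrite -{1}(allv x) !inE eqxx.
  by rewrite cards1.
have hit k : k \notin bad -> exists x y, [/\ x \in C k, y \in C k, f x \in X & f y \in Y].
  move=> kb; have [ck _] := Cv k.
  have [x xk par_eq] := odd_cycle_monochromatic (par \o f) ck (odd_petal k).
  have eE := badP k kb x xk.
  have eq : f @: [set x; next (C k) x] = [set f x; f (next (C k) x)].
    by rewrite imsetU !imset_set1.
  have nk : next (C k) x \in C k by rewrite mem_next.
  have [[fx fy]|[fx fy]] := EXY _ _ _ eE eq (esym par_eq).
    by exists x, (next (C k) x).
  by exists (next (C k) x), x.
(* The vertices of [H] mapped into [Z] differ from [v], so each lies on a single cycle; the at least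
   [s + t - 1] cycles outside [bad] need distinct ones. *)
have count (Z : {set K n}) : #|Z| < (s + t).-1 -> f v \notin Z ->
    (forall k, k \notin bad -> exists2 x, x \in C k & f x \in Z) -> False.
  move=> szZ vZ hitZ; pose Z' := [set x | f x \in Z].
  have sub : ~: bad \subset petal @: Z'.
    apply/subsetP => k; rewrite inE => /hitZ[x xk xZ].
    apply/imsetP; exists x; rewrite ?inE // (@petalE x k) //.
    by apply: contraNneq vZ => <-.
  have szZ' : #|Z'| <= #|Z|.
    rewrite -(card_imset _ f_inj); apply: subset_leq_card.
    by apply/subsetP => _ /imsetP[x + ->]; rewrite inE.
  have := subset_leq_card sub; have := leq_imset_card petal Z'.
  have := cardsC bad; rewrite card_sum !card_ord; move: szZ szZ' bad1; clear; lia.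
have [vX|vX] := boolP (f v \in X); last first.
  by apply: (count X szX vX) => k /hit[x [y [xk _ fx _]]]; exists x.
apply: (count Y szY); first by rewrite (disjointFr dXY vX).
by move=> k /hit[x [y [_ yk _ fy]]]; exists y.
Qed.

End Hst.

(** * The extremal coloring and the final count *)

Lemma edges_K n : edges (K n) = pairs setT.
Proof. by apply/setP => e; rewrite !inE subsetT. Qed.

Lemma ncolorsE (G : sgraph) (C : finType) (c : {set G} -> C) :
  ncolors c = #|c @: edges G|.
Proof.
rewrite /ncolors -(card_uniqP (undup_uniq _)); apply: eq_card => g.
rewrite mem_undup; apply/imageP/imsetP => -[e eG ->]; by exists e.
Qed.

(* The edges of [T2 n] and of a [K_{j,j}] inside its even part get distinct colors, all other
   edges share one further color. *)
Lemma ar_lower (s t n : nat) (H : sgraph) :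
  is_Hst s t H -> 0 < t -> 2 <= s + t -> 4 * (s + t) + 4 <= n ->
  t2 n + (s + t - 2) ^ 2 + 1 <= ar n H.
Proof.
move=> [v [C [Cv C3 C5 Cdis [Ccov HE]]]] t0 st2 nbig; set j := s + t - 2.
pose Od := [set x : 'I_n | odd x].
have szOd : #|Od| = n./2 := card_odd_ord n.
have szEv : #|~: Od| = n - n./2 by rewrite cardsCs setCK card_ord szOd.
have [|X sX szX] := @subset_of_card _ (~: Od) j.
  by rewrite szEv /j; move: nbig; clear; lia.
have [|Y sY szY] := @subset_of_card _ (~: Od :\: X) j.
  by rewrite cardsD (setIidPr sX) szEv szX /j; move: nbig; clear; lia.
have dXY : [disjoint X & Y].
  by rewrite disjoint_sym disjoint_subset; apply/subsetP => y /(subsetP sY); rewrite !inE => /andP[].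
have XYneq x y : x \in X -> y \in Y -> x != y.
  by move=> xX; apply: contraTneq => <-; rewrite (disjointFr dXY xX).
have evX x : x \in X -> ~~ odd x by move/(subsetP sX); rewrite !inE.
have evY y : y \in Y -> ~~ odd y by move/(subsetP sY); rewrite !inE => /andP[].
pose KK : {set {set K n}} := [set [set p.1; p.2] | p in setX X Y].
have KKP e : reflect (exists x y, [/\ x \in X, y \in Y & e = [set x; y]]) (e \in KK).
  apply: (iffP imsetP) => [[[x y]]|[x [y [xX yY ->]]]].
    by rewrite !inE /= => /andP[xX yY ->]; exists x, y.
  by exists (x, y); rewrite // !inE xX.
have szKK : #|KK| = j ^ 2.
  rewrite card_in_imset ?cardsX ?szX ?szY // => -[x y] [x' y'].
  rewrite !inE /= => /andP[xX yY] /andP[xX' yY'] /setP eq.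
  have nXY z : z \in X -> z \in Y -> False by move=> zX; rewrite (disjointFr dXY zX).
  have := eq x; rewrite !inE eqxx /= => /esym/orP[]/eqP xE; last by case: (nXY x); rewrite ?xX // xE.
  have := eq y; rewrite !inE eqxx orbT => /esym/orP[]/eqP yE; first by case: (nXY y); rewrite ?yY // yE.
  by rewrite xE yE.
pose E0 : {set {set K n}} := edges (T2 n) :|: KK.
have T2P e : reflect (exists x y : 'I_n, odd x != odd y /\ e = [set x; y]) (e \in edges (T2 n)).
  apply: (iffP imsetP) => [[[x y]]|[x [y [xy ->]]]].
    by rewrite inE /= => xy ->; exists x, y.
  by exists (x, y); rewrite // inE.
have szE0 : #|E0| = t2 n + j ^ 2.
  rewrite cardsU szKK [X in _ - X]eq_card0 ?subn0 // => e; rewrite inE.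
  apply/negP => /andP[/T2P[x [y [xy ->]]] /KKP[x' [y' [xX yY /setP eq]]]].
  have ev z : z \in [set x; y] -> ~~ odd z.
    by rewrite eq !inE => /orP[]/eqP->; [apply: evX | apply: evY].
  have [ex ey] : ~~ odd x /\ ~~ odd y by split; apply: ev; rewrite !inE eqxx ?orbT.
  by move: xy; rewrite (negPf ex) (negPf ey).
have E0K : E0 \subset edges (K n).
  apply/subsetP => e; rewrite !inE => /orP[/edgesP -> //|/KKP[x [y [xX yY ->]]]].
  by rewrite cards2; have -> := XYneq x y xX yY.
pose col (e : {set K n}) : option {set K n} := if e \in E0 then Some e else None.
(* Two odd vertices, whose edge lies outside [E0], so that the further color [None] does occur. *)
have [|a aO aN] := @pick_notin _ Od set0; first by rewrite cards0 szOd; move: nbig; clear; lia.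
have [|b bO bN] := @pick_notin _ Od [set a]; first by rewrite cards1 szOd; move: nbig; clear; lia.
rewrite !inE in aO bO bN.
have abK : [set a; b] \in edges (K n) by rewrite inE cards2 [a == b]eq_sym bN.
have abE : [set a; b] \notin E0.
  rewrite inE negb_or; apply/andP; split; apply/negP.
    case/T2P=> x [y [xy /setP eq]].
    have od z : z \in [set x; y] -> odd z by rewrite -eq !inE => /orP[]/eqP->.
    by move: xy; rewrite !od ?inE ?eqxx ?orbT.
  case/KKP=> x [y [xX _ /setP/(_ x)]]; rewrite !inE eqxx /= => /orP[]/eqP xE;
    by have := evX x xX; rewrite xE ?aO ?bO.
have nocopy : ~~ has_rainbow_copy H col.
  apply: (no_rainbow_copy Cv C3 C5 Cdis Ccov HE (inr (Ordinal t0)) (X := X) (Y := Y)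
    (par := fun x : 'I_n => odd x) (E := E0) dXY).
  - by rewrite szX /j; move: st2; clear; lia.
  - by rewrite szY /j; move: st2; clear; lia.
  - move=> e x y; rewrite inE => /orP[/T2P[x' [y' [xy' eE]]]|/KKP[x' [y' [xX yY eE]]]] eE' par.
      have /setP eq : [set x; y] = [set x'; y'] by rewrite -eE' eE.
      have same z : z \in [set x'; y'] -> odd z = odd x.
        by rewrite -eq !inE => /orP[]/eqP->.
      by move: xy'; rewrite (same x') ?(same y') ?inE ?eqxx ?orbT.
    have /setP eq : [set x; y] = [set x'; y'] by rewrite -eE' eE.
    have xy : x != y.
      have := cards2 x y; rewrite -[#|_|]/(#|[set x; y]|) -eE' eE cards2.
      have -> := XYneq x' y' xX yY.
      by case: (x != y).
    have := eq x; rewrite !inE eqxx /= => /esym/orP[]/eqP xE; have := eq y;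
      rewrite !inE eqxx orbT => /esym/orP[]/eqP yE.
    + by rewrite xE yE eqxx in xy.
    + by left; rewrite xE yE.
    + by right; rewrite xE yE.
    + by rewrite xE yE eqxx in xy.
  - by move=> e eE; rewrite /col (negPf eE).
apply: leq_trans (leq_ar nocopy); rewrite ncolorsE.
have NoneIm : None \notin [set Some e | e in E0] by apply/negP => /imsetP[].
have <- : #|None |: [set Some e | e in E0]| = t2 n + j ^ 2 + 1.
  by rewrite cardsU1 NoneIm card_imset ?szE0 1?addnC //; apply: Some_inj.
apply: subset_leq_card; rewrite subUset sub1set; apply/andP; split.
  by apply/imsetP; exists [set a; b]; rewrite // /col (negPf abE).
apply/subsetP => _ /imsetP[e eE ->]; apply/imsetP; exists e; rewrite ?(subsetP E0K) //.
by rewrite /col eE.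
Qed.

Theorem theorem1p1 (s t : nat) (ht : 1 <= t) (hst : 2 <= s + t)
    (H : sgraph) (hH : is_Hst s t H) :
  exists n0 : nat, forall n : nat, n0 <= n ->
    ar n H = t2 n + (s + t - 2) ^ 2 + 1.
Proof.
have [v [C [Cv C3 C5 Cdis [Ccov HE]]]] := hH.
(* [k0] is a cycle of length at least 5, which exists as [1 <= t]; [ls] lists the lengths of the
   other [s + t - 1] cycles. *)
pose k0 : 'I_s + 'I_t := inr (Ordinal ht).
pose ks := rem k0 (enum {: 'I_s + 'I_t}).
pose l := size (C k0); pose ls := [seq size (C k) | k <- ks].
have k0in : k0 \in enum {: 'I_s + 'I_t} by rewrite mem_enum.
have uks : uniq (k0 :: ks).
  by rewrite -(perm_uniq (perm_to_rem k0in)) enum_uniq.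
have allks k : k \in k0 :: ks.
  by rewrite -(perm_mem (perm_to_rem k0in)) mem_enum.
have ol : all odd (l :: ls).
  by apply/allP => _ /(@mapP _ _ (fun k => size (C k)) (k0 :: ks))[k _ ->]; apply: (odd_petal C3 C5).
have ls3 : all (leq 3) ls.
  apply/allP => _ /mapP[[i|i] _ ->]; first by rewrite C3.
  by case: (C5 i) => _; apply: leq_trans.
have l5 : 5 <= l by case: (C5 (Ordinal ht)).
have szls : size ls = (s + t).-1.
  by rewrite size_map size_rem // -cardE card_sum !card_ord.
have ls0 : 0 < size ls by rewrite szls; move: hst; clear; lia.
pose m := size_threshold (sumn (l :: ls)).+1.
(* The summand [m * m + m] is for [colors_le], the rest for [ar_lower]. *)
exists (m * m + m + 4 * (s + t) + 5) => n nbig; apply/eqP; rewrite eqn_leq; apply/andP; split.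
  apply/bigmax_leqP => c cH; rewrite ncolorsE edges_K t2E.
  have nfl (E : {set {set K n}}) (w : K n) : E \subset pairs setT -> rainbow_set c E -> ~ flower E w (l :: ls).
    move=> EU rE fl; case/negP: cH.
    exact: (flower_copy Cv Cdis Ccov HE k0 uks allks EU rE fl).
  have := colors_le ol ls3 l5 ls0 nfl.
  rewrite card_ord szls -/m => /(_ _)/leq_trans; apply; first by move: nbig; clear; lia.
  by have -> : (s + t).-1.-1 = s + t - 2 by clear; lia.
by apply: ar_lower => //; move: nbig; clear; lia.
Qed.
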